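(* Let $\mathbf{X}^*\in\mathbb{R}^{n_1\times n_2}$ have rank $r$ and condition number $\kappa=\sigma_1(\mathbf{X}^* )/\sigma_r(\mathbf{X}^* )$, with skinny SVD $\mathbf{U}\mathbf{\Sigma}\mathbf{V}^T$, and suppose $\mathbf{X}^*$ obeys $\mu$-incoherence: $\|\mathbf{U}^T\mathbf{e}_i\|_2\le\sqrt{\mu r/n_1}$ and $\|\mathbf{V}^T\mathbf{e}_i\|_2\le\sqrt{\mu r/n_2}$ for all $i$. Let $\Omega\subseteq[n_1]\times[n_2]$ be drawn uniformly at random among all subsets of cardinality $m$. There is an absolute constant $c$ such that if $m\ge c\kappa^2\mu n_{(1)}r\log n_{(1)}\log_{2\kappa}n_{(1)}$, then with probability at least $1-n_{(1)}^{-10}$, $\mathbf{X}^*$ is the unique solution of the non-convex problem $$\min_{\mathbf{A}\in\mathbb{R}^{n_1\times r},\mathbf{B}\in\mathbb{R}^{r\times n_2}}\frac{1}{2}\|\mathbf{A}\mathbf{B}\|_F^2\quad\text{s.t.}\quad\mathcal{P}_\Omega(\mathbf{A}\mathbf{B})=\mathcal{P}_\Omega(\mathbf{X}^* ),$$ in the sense that every optimal $(\mathbf{A},\mathbf{B})$ satisfies $\mathbf{A}\mathbf{B}=\mathbf{X}^*$.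
   Context: $n_{(1)}=\max\{n_1,n_2\}$, $n_{(2)}=\min\{n_1,n_2\}$. $\mathbf{e}_i$ is the $i$-th standard basis vector. $\mathcal{P}_\Omega$ is the orthogonal projector that keeps the entries indexed by $\Omega$ and sets all other entries to zero. *)

(* Defs.v *)
From mathcomp Require Import all_boot all_order all_algebra.
From mathcomp Require Import boolp reals exp.

Set Implicit Arguments.
Unset Strict Implicit.
Unset Printing Implicit Defensive.

Import Order.TTheory GRing.Theory Num.Theory.
Local Open Scope ring_scope.

(* The norm that MathComp-Analysis puts on matrices is the sup norm, hence the
   explicit Euclidean and Frobenius norms. *)
Definition norm2 (R : realType) (n : nat) (v : 'cV[R]_n) : R :=
  Num.sqrt (\sum_(i < n) v i 0 ^+ 2).

Definition normF (R : realType) (n1 n2 : nat) (A : 'M[R]_(n1, n2)) : R :=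
  Num.sqrt (\sum_(i < n1) \sum_(j < n2) A i j ^+ 2).

Definition std_basis (R : realType) (n : nat) (i : 'I_n) : 'cV[R]_n :=
  delta_mx i 0.

Arguments std_basis R {n} i.

(* [s] lists the nonzero singular values, i.e. the diagonal of Sigma, in
   non-increasing order. *)
Definition skinny_svd (R : realType) (n1 n2 r : nat) (X : 'M[R]_(n1, n2))
    (U : 'M[R]_(n1, r)) (s : 'rV[R]_r) (V : 'M[R]_(n2, r)) : Prop :=
  [/\ U^T *m U = 1%:M,
      V^T *m V = 1%:M,
      forall i, 0 < s 0 i,
      forall i j : 'I_r, (i <= j)%N -> s 0 j <= s 0 i
    & X = U *m diag_mx s *m V^T].

(* sigma_k in the usual 1-based numbering; the default value 0 is returned only
   when k is not in {1, ..., r} ([k.-1] sends k = 0 to the first entry). *)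
Definition sing_val (R : realType) (r : nat) (s : 'rV[R]_r) (k : nat) : R :=
  oapp (s 0) 0 (insub k.-1).

Definition cond_number (R : realType) (r : nat) (s : 'rV[R]_r) : R :=
  sing_val s 1 / sing_val s r.

Definition incoherent (R : realType) (n1 n2 r : nat) (mu : R)
    (U : 'M[R]_(n1, r)) (V : 'M[R]_(n2, r)) : Prop :=
  (forall i : 'I_n1,
     norm2 (U^T *m std_basis R i) <= Num.sqrt (mu * r%:R / n1%:R)) /\
  (forall i : 'I_n2,
     norm2 (V^T *m std_basis R i) <= Num.sqrt (mu * r%:R / n2%:R)).

Definition proj_obs (R : realType) (n1 n2 : nat) (Omega : {set 'I_n1 * 'I_n2})
    (M : 'M[R]_(n1, n2)) : 'M[R]_(n1, n2) :=
  \matrix_(i, j) (if (i, j) \in Omega then M i j else 0).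

Definition feasible (R : realType) (n1 n2 r : nat) (X : 'M[R]_(n1, n2))
    (Omega : {set 'I_n1 * 'I_n2}) (A : 'M[R]_(n1, r)) (B : 'M[R]_(r, n2)) :
    Prop :=
  proj_obs Omega (A *m B) = proj_obs Omega X.

Definition objective (R : realType) (n1 n2 r : nat)
    (A : 'M[R]_(n1, r)) (B : 'M[R]_(r, n2)) : R :=
  2^-1 * normF (A *m B) ^+ 2.

Definition optimal (R : realType) (n1 n2 r : nat) (X : 'M[R]_(n1, n2))
    (Omega : {set 'I_n1 * 'I_n2}) (A : 'M[R]_(n1, r)) (B : 'M[R]_(r, n2)) :
    Prop :=
  feasible X Omega A B /\
  forall (A' : 'M[R]_(n1, r)) (B' : 'M[R]_(r, n2)),
    feasible X Omega A' B' -> objective A B <= objective A' B'.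

(* A factorization is never unique as a pair (A, B), so uniqueness is about the
   product A *m B. *)
Definition unique_solution (R : realType) (n1 n2 r : nat)
    (X : 'M[R]_(n1, n2)) (Omega : {set 'I_n1 * 'I_n2}) : Prop :=
  (exists (A : 'M[R]_(n1, r)) (B : 'M[R]_(r, n2)),
     optimal X Omega A B /\ A *m B = X) /\
  (forall (A : 'M[R]_(n1, r)) (B : 'M[R]_(r, n2)),
     optimal X Omega A B -> A *m B = X).

Arguments unique_solution {R n1 n2} r X Omega.

(* Probability of [E] under the uniform law on the m-element subsets of T;
   meaningful when m <= #|T|, the value being the junk 0 / 0 = 0 otherwise. *)
Definition prob_subset (R : realType) (T : finType) (m : nat)
    (E : {set T} -> Prop) : R :=
  #|[set Omega : {set T} | (#|Omega| == m) && `[< E Omega >]]|%:R /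
  #|[set Omega : {set T} | #|Omega| == m]|%:R.

Arguments prob_subset R {T} m E.

Definition logb (R : realType) (b x : R) : R := ln x / ln b.

(* Main.v *)
(** A matrix Y supported on Omega with P_T Y = X, whose component W orthogonal to
    the tangent space T = {U A + B V^T} has operator norm below sigma_r, certifies
    uniqueness.  For a feasible product Z = A B, let Q be the projector onto its
    row space: then |X|^2 = <Y, X> = <Y, Z> = <Y Q, Z> <= |Y Q| |Z|, and by Ky Fan
    |Y Q| <= |X|, with equality only if Q fixes the row space of X; hence
    |X| <= |Z|, with equality only for Z = X.

    Such a Y is built by golfing.  By a coupling with random permutations the
    m-subset may be replaced by a shorter i.i.d. sequence, cut into batches.  Each
    batch shrinks the residual on T by a factor 2 kappa, in its entries and in the
    norms of its rows and columns, and adds at most a geometrically decreasing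
    amount to W; about 9 log_(2 kappa) n batches make the residual polynomially
    small, and a last batch, whose sampling operator is coercive on T, removes it
    exactly.

    All deviations are controlled by a matrix Bernstein inequality proved with
    (1 + A/K)^K, K = 2^k, instead of exp A: the trace inequality
    tr (X Y)^(2^k) <= tr X^(2^k) Y^(2^k) for symmetric X, Y, proved by induction
    on k together with tr M^(2^(k+1)) <= tr (M M^T)^(2^k), replaces
    Golden-Thompson, and the error of order 1/K is removed by taking K large. *)

Require Import Defs.
From HB Require Import structures.
From mathcomp Require Import all_boot all_order all_algebra perm.
From mathcomp Require Import boolp reals sequences exp.
From mathcomp Require Import ring lra zify.

Set Implicit Arguments.
Unset Strict Implicit.
Unset Printing Implicit Defensive.

Import Order.TTheory GRing.Theory Num.Theory.
Local Open Scope ring_scope.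

(** * Frobenius inner product and operator norm *)

(** The certificate has to reproduce [X] itself and not U V^T: golfing starts from a matrix of size
    sigma_1, while the part off T must stay below sigma_r. So already the first batch has to gain a
    factor kappa. Bernstein charges kappa^2 in the batch size for it, and every later batch gains 2
    kappa at the same price, whence the base of the logarithm. Golfing alone never reaches P_T Y =
    X, and the exact correction may amplify the residual by sqrt (2 n1 n2); this is why the scale of
    the residual is first brought down to sigma_1 n^(-9).

    Eigenvalues never appear: a norm bound is an inequality between quadratic forms, positivity
    comes from even powers of symmetric matrices, and the trace of such a power is bounded below
    through a single Rayleigh quotient.

    In the constant 11 * 2^18, 2^17 is the price of a batch whose failure is n^(-32) up to dimension
    factors, a factor 2 covers the rounding of the batch size, and 11 covers the golfing batches,
    the rounding of their number and the last batch. *)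

Definition dot (R : realFieldType) (m n : nat) (A B : 'M[R]_(m, n)) : R :=
  \tr (A^T *m B).

Lemma dotE (R : realFieldType) m n (A B : 'M[R]_(m, n)) :
  dot A B = \sum_i \sum_j A i j * B i j.
Proof.
rewrite /dot /mxtrace exchange_big; apply: eq_bigr => j _.
by rewrite mxE; apply: eq_bigr => i _; rewrite mxE.
Qed.

Lemma dotC (R : realFieldType) m n (A B : 'M[R]_(m, n)) : dot A B = dot B A.
Proof. by rewrite /dot -mxtrace_tr trmx_mul trmxK. Qed.

Lemma dotDl (R : realFieldType) m n (A B C : 'M[R]_(m, n)) :
  dot (A + B) C = dot A C + dot B C.
Proof. by rewrite /dot linearD mulmxDl linearD. Qed.

Lemma dotDr (R : realFieldType) m n (A B C : 'M[R]_(m, n)) :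
  dot A (B + C) = dot A B + dot A C.
Proof. by rewrite /dot mulmxDr linearD. Qed.

Lemma dotZl (R : realFieldType) m n a (A B : 'M[R]_(m, n)) :
  dot (a *: A) B = a * dot A B.
Proof. by rewrite /dot linearZ -scalemxAl linearZ. Qed.

Lemma dotZr (R : realFieldType) m n a (A B : 'M[R]_(m, n)) :
  dot A (a *: B) = a * dot A B.
Proof. by rewrite dotC dotZl dotC. Qed.

Lemma dotNl (R : realFieldType) m n (A B : 'M[R]_(m, n)) :
  dot (- A) B = - dot A B.
Proof. by rewrite -scaleN1r dotZl mulN1r. Qed.

Lemma dotNr (R : realFieldType) m n (A B : 'M[R]_(m, n)) :
  dot A (- B) = - dot A B.
Proof. by rewrite dotC dotNl dotC. Qed.

Lemma dotBl (R : realFieldType) m n (A B C : 'M[R]_(m, n)) :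
  dot (A - B) C = dot A C - dot B C.
Proof. by rewrite dotDl dotNl. Qed.

Lemma dotBr (R : realFieldType) m n (A B C : 'M[R]_(m, n)) :
  dot A (B - C) = dot A B - dot A C.
Proof. by rewrite dotDr dotNr. Qed.

Lemma dot0l (R : realFieldType) m n (A : 'M[R]_(m, n)) : dot 0 A = 0.
Proof. by rewrite -(scale0r A) dotZl mul0r. Qed.

Lemma dot0r (R : realFieldType) m n (A : 'M[R]_(m, n)) : dot A 0 = 0.
Proof. by rewrite dotC dot0l. Qed.

Lemma dot_suml (R : realFieldType) (I : Type) (r : seq I) m n
    (F : I -> 'M[R]_(m, n)) B :
  dot (\sum_(i <- r) F i) B = \sum_(i <- r) dot (F i) B.
Proof.
by elim/big_rec2: _ => [|i x y _ <-]; rewrite ?dot0l ?dotDl.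
Qed.

Lemma dot_sumr (R : realFieldType) (I : Type) (r : seq I) m n
    (F : I -> 'M[R]_(m, n)) B :
  dot B (\sum_(i <- r) F i) = \sum_(i <- r) dot B (F i).
Proof. by rewrite dotC dot_suml; apply: eq_bigr => i _; rewrite dotC. Qed.

Lemma dot_trmx (R : realFieldType) m n (A B : 'M[R]_(m, n)) :
  dot A^T B^T = dot A B.
Proof. by rewrite /dot -trmx_mul mxtrace_tr mxtrace_mulC. Qed.

Lemma dot_mull (R : realFieldType) m n p (C : 'M[R]_(p, m)) (A : 'M[R]_(p, n))
    (B : 'M[R]_(m, n)) :
  dot A (C *m B) = dot (C^T *m A) B.
Proof. by rewrite /dot trmx_mul trmxK mulmxA. Qed.

Lemma dot_mulr (R : realFieldType) m n p (C : 'M[R]_(n, p)) (A : 'M[R]_(m, p))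
    (B : 'M[R]_(m, n)) :
  dot A (B *m C) = dot (A *m C^T) B.
Proof. by rewrite -dot_trmx trmx_mul dot_mull -dot_trmx trmxK trmx_mul !trmxK. Qed.

Lemma dot_ge0 (R : realFieldType) m n (A : 'M[R]_(m, n)) : 0 <= dot A A.
Proof.
by rewrite dotE; apply: sumr_ge0 => i _; apply: sumr_ge0 => j _; exact: sqr_ge0.
Qed.

Lemma dot_eq0 (R : realFieldType) m n (A : 'M[R]_(m, n)) :
  dot A A = 0 -> A = 0.
Proof.
rewrite dotE => /eqP; rewrite psumr_eq0; last first.
  by move=> i _; apply: sumr_ge0 => j _; exact: sqr_ge0.
move=> /allP h; apply/matrixP => i j; rewrite mxE.
have /implyP /(_ isT) := h i (mem_index_enum _).
rewrite psumr_eq0; last by move=> k _; exact: sqr_ge0.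
move=> /allP /(_ j (mem_index_enum _)) /=.
by rewrite mulf_eq0 orbb => /eqP.
Qed.

Lemma dot_gt0 (R : realFieldType) m n (A : 'M[R]_(m, n)) :
  A != 0 -> 0 < dot A A.
Proof.
by move=> A0; rewrite lt_def dot_ge0 andbT; apply: contra A0 => /eqP /dot_eq0 ->.
Qed.

Lemma cauchy_schwarz (R : realFieldType) m n (A B : 'M[R]_(m, n)) :
  dot A B ^+ 2 <= dot A A * dot B B.
Proof.
have [->|B0] := eqVneq B 0; first by rewrite !dot0r expr0n mulr0.
have b0 := dot_gt0 B0.
have := dot_ge0 (dot B B *: A - dot A B *: B).
rewrite dotBl !dotBr !dotZl !dotZr (dotC B A) => h.
rewrite -(ler_pM2l b0); nra.
Qed.

Lemma dot_le_mean (R : realFieldType) m n (A B : 'M[R]_(m, n)) :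
  dot A B *+ 2 <= dot A A + dot B B.
Proof.
have := dot_ge0 (A - B); rewrite dotBl !dotBr (dotC B A) mulr2n; lra.
Qed.

Lemma dot_scale_le (R : realFieldType) m n (A B : 'M[R]_(m, n)) (a b : R) :
  0 <= a -> 0 <= b -> dot A A <= a ^+ 2 -> dot B B <= b ^+ 2 -> dot A B <= a * b.
Proof.
move=> a0 b0 hA hB; have h := cauchy_schwarz A B.
have {}h : dot A B ^+ 2 <= (a * b) ^+ 2.
  by rewrite exprMn; apply: le_trans h _; apply: ler_pM => //; exact: dot_ge0.
have [ab|/ltW ab] := leP 0 (dot A B); last exact: le_trans ab (mulr_ge0 a0 b0).
by rewrite -(@ler_pXn2r _ 2) // nnegrE // ?mulr_ge0.
Qed.

Lemma minkowski (R : realFieldType) m n (A B : 'M[R]_(m, n)) (a b : R) :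
  0 <= a -> 0 <= b -> dot A A <= a ^+ 2 -> dot B B <= b ^+ 2 ->
  dot (A + B) (A + B) <= (a + b) ^+ 2.
Proof.
move=> a0 b0 hA hB; have h := dot_scale_le a0 b0 hA hB.
by rewrite dotDl !dotDr (dotC B A); nra.
Qed.

(* The operator norm of [M] is at most [`|t|]. *)
Definition opb (R : realFieldType) (m n : nat) (t : R) (M : 'M[R]_(m, n)) : Prop :=
  forall x : 'cV[R]_n, dot (M *m x) (M *m x) <= t ^+ 2 * dot x x.

Lemma dot_col (R : realFieldType) m n (A B : 'M[R]_(m, n)) :
  dot A B = \sum_j dot (col j A) (col j B).
Proof.
rewrite dotE exchange_big; apply: eq_bigr => j _; rewrite dotE.
by apply: eq_bigr => i _; rewrite big_ord1 !mxE.
Qed.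

Lemma opb_mx (R : realFieldType) m n p t (M : 'M[R]_(m, n)) (N : 'M[R]_(n, p)) :
  opb t M -> dot (M *m N) (M *m N) <= t ^+ 2 * dot N N.
Proof.
move=> h; rewrite !(dot_col _ _) mulr_sumr; apply: ler_sum => j _.
by rewrite !colE -mulmxA.
Qed.

Lemma opbM (R : realFieldType) m n p a b (M : 'M[R]_(m, n)) (N : 'M[R]_(n, p)) :
  opb a M -> opb b N -> opb (a * b) (M *m N).
Proof.
move=> hM hN x; rewrite -mulmxA; apply: le_trans (hM _) _.
rewrite exprMn -[leRHS]mulrA; apply: ler_wpM2l; [exact: sqr_ge0|exact: hN].
Qed.

Lemma opb1 (R : realFieldType) n : opb 1 (1%:M : 'M[R]_n).
Proof. by move=> x; rewrite mul1mx expr1n mul1r. Qed.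

Lemma opb0 (R : realFieldType) m n t : opb t (0 : 'M[R]_(m, n)).
Proof. by move=> x; rewrite mul0mx dot0l mulr_ge0 ?sqr_ge0 ?dot_ge0. Qed.

Lemma opbZ (R : realFieldType) m n t c (M : 'M[R]_(m, n)) :
  opb t M -> opb (c * t) (c *: M).
Proof.
move=> h x; rewrite -scalemxAl dotZl dotZr mulrA -expr2 exprMn -[leRHS]mulrA.
by apply: ler_wpM2l; [exact: sqr_ge0|exact: h].
Qed.

Lemma opbN (R : realFieldType) m n t (M : 'M[R]_(m, n)) : opb t M -> opb t (- M).
Proof. by move=> h x; rewrite mulNmx dotNl dotNr opprK. Qed.

Lemma opbW (R : realFieldType) m n a b (M : 'M[R]_(m, n)) :
  0 <= a -> a <= b -> opb a M -> opb b M.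
Proof.
move=> a0 ab h x; apply: le_trans (h x) _; rewrite ler_wpM2r ?dot_ge0 //.
by rewrite ler_pXn2r // nnegrE // (le_trans a0).
Qed.

Lemma opbD (R : realFieldType) m n a b (M N : 'M[R]_(m, n)) :
  0 <= a -> 0 <= b -> opb a M -> opb b N -> opb (a + b) (M + N).
Proof.
move=> a0 b0 hM hN x; rewrite mulmxDl dotDl !dotDr (dotC (N *m x)).
have hm := hM x; have hn := hN x; have x0 := dot_ge0 x.
have cs := cauchy_schwarz (M *m x) (N *m x).
have {}cs : dot (M *m x) (N *m x) ^+ 2 <= (a * b * dot x x) ^+ 2.
  apply: le_trans cs _; rewrite [leRHS](_ : _ = (a ^+ 2 * dot x x) * (b ^+ 2 * dot x x)); last by ring.
  by apply: ler_pM => //; exact: dot_ge0.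
have : dot (M *m x) (N *m x) <= a * b * dot x x.
  have [ab|/ltW ab] := leP 0 (dot (M *m x) (N *m x)); last first.
    by apply: le_trans ab _; rewrite !mulr_ge0.
  by rewrite -(@ler_pXn2r _ 2) // nnegrE // !mulr_ge0.
by nra.
Qed.

Lemma opb_sum (R : realFieldType) (I : Type) (r : seq I) m n (t : I -> R)
    (F : I -> 'M[R]_(m, n)) :
  (forall i, 0 <= t i) -> (forall i, opb (t i) (F i)) ->
  opb (\sum_(i <- r) t i) (\sum_(i <- r) F i).
Proof.
move=> t0 h; elim: r => [|i r IH]; first by rewrite !big_nil; exact: opb0.
by rewrite !big_cons; apply: opbD => //; exact: sumr_ge0.
Qed.

(** Duality without singular values: for y = M^T x one has |y|^2 = <x, M y>, so Cauchy-Schwarz gives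
    |y|^4 <= |x|^2 t^2 |y|^2, and |y|^2 cancels. *)
Lemma opb_trmx (R : realFieldType) m n t (M : 'M[R]_(m, n)) : opb t M -> opb t M^T.
Proof.
move=> h x; set y := M^T *m x.
have e : dot y y = dot x (M *m y) by rewrite dot_mull.
have cs := cauchy_schwarz x (M *m y); rewrite -e in cs.
have h1 := h y; have x0 := dot_ge0 x; have y0 := dot_ge0 y.
have [->|yn0] := eqVneq y 0; first by rewrite dot0l mulr_ge0 ?sqr_ge0.
have yp := dot_gt0 yn0; rewrite -(ler_pM2l yp); nra.
Qed.

Lemma dot_mulmx_le (R : realFieldType) m n (M : 'M[R]_(m, n)) (x : 'cV[R]_n) :
  dot (M *m x) (M *m x) <= dot M M * dot x x.
Proof.
rewrite -[dot M M]dot_trmx (dot_col M^T) mulr_suml [leLHS]dotE.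
apply: ler_sum => i _; rewrite big_ord1 -expr2.
apply: le_trans (cauchy_schwarz _ _); rewrite le_eqVlt; apply/orP; left; apply/eqP.
congr (_ ^+ 2); rewrite mxE dotE; apply: eq_bigr => j _.
by rewrite big_ord1 !mxE.
Qed.

Lemma opb_frob (R : realFieldType) m n t (M : 'M[R]_(m, n)) :
  dot M M <= t ^+ 2 -> opb t M.
Proof.
move=> h x; apply: le_trans (dot_mulmx_le _ _) _.
by rewrite ler_wpM2r ?dot_ge0.
Qed.

(** * Trace inequalities *)

Definition symmx (R : realFieldType) (n : nat) (A : 'M[R]_n) : Prop := A^T = A.

Lemma trmxM (R : realFieldType) n (A B : 'M[R]_n) : (A * B)^T = B^T * A^T.
Proof. exact: trmx_mul. Qed.

Lemma trmxX (R : realFieldType) n (A : 'M[R]_n) k : (A ^+ k)^T = A^T ^+ k.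
Proof.
by elim: k => [|k IH]; rewrite ?expr0 ?trmx1 // exprS trmxM IH -exprSr.
Qed.

Lemma scalemxMl (R : realFieldType) n c (A B : 'M[R]_n) : (c *: A) * B = c *: (A * B).
Proof. exact/esym/scalemxAl. Qed.

Lemma scalemxMr (R : realFieldType) n c (A B : 'M[R]_n) : A * (c *: B) = c *: (A * B).
Proof. exact/esym/scalemxAr. Qed.

Lemma mxtrace_mulrC (R : realFieldType) n (A B : 'M[R]_n) :
  \tr (A * B) = \tr (B * A).
Proof. exact: mxtrace_mulC. Qed.

Lemma dot_sq (R : realFieldType) n (A B : 'M[R]_n) : dot A B = \tr (A^T * B).
Proof. by []. Qed.

Lemma mulX_cycle (R : realFieldType) n (A B : 'M[R]_n) k :
  A * (B * A) ^+ k = (A * B) ^+ k * A.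
Proof.
elim: k => [|k IH]; first by rewrite !expr0 mulr1 mul1r.
by rewrite exprSr mulrA IH exprSr !mulrA.
Qed.

Lemma mxtraceX_cycle (R : realFieldType) n (A B : 'M[R]_n) k :
  \tr ((A * B) ^+ k) = \tr ((B * A) ^+ k).
Proof.
case: k => [|k]; first by rewrite !expr0.
by rewrite exprSr mulrA -mulX_cycle mxtrace_mulrC mulrA -exprS.
Qed.

Lemma symmxX (R : realFieldType) n (A : 'M[R]_n) k : symmx A -> symmx (A ^+ k).
Proof. by rewrite /symmx trmxX => ->. Qed.

Lemma symmxMT (R : realFieldType) n (A : 'M[R]_n) : symmx (A * A^T).
Proof. by rewrite /symmx trmxM trmxK. Qed.

Lemma symmxTM (R : realFieldType) n (A : 'M[R]_n) : symmx (A^T * A).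
Proof. by rewrite /symmx trmxM trmxK. Qed.

(** The two halves feed each other. For the first, the induction hypothesis at M^2 yields M^2
    (M^T)^2, cyclically (M M^T)(M^T M); the second half applies to these two factors, and the
    resulting inner product is at most the mean of two equal traces. For the second, the first half
    at X Y yields X Y^2 X, cyclically X^2 Y^2, and the second half applies to the squares. *)
Lemma mxtraceX_GT (R : realFieldType) n k :
  (forall M : 'M[R]_n, \tr (M ^+ (2 ^ k.+1)) <= \tr ((M * M^T) ^+ (2 ^ k))) /\
  (forall X Y : 'M[R]_n, symmx X -> symmx Y ->
     \tr ((X * Y) ^+ (2 ^ k)) <= \tr (X ^+ (2 ^ k) * Y ^+ (2 ^ k))).
Proof.
elim: k => [|k [IHA IHB]]; split.
- move=> M; rewrite expn1 expn0 expr1.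
  have := dot_le_mean M^T M.
  by rewrite !dot_sq trmxK mulr2n -expr2 (mxtrace_mulrC M^T); lra.
- by move=> X Y _ _; rewrite expn0 !expr1.
- move=> M; rewrite expnS exprM; apply: le_trans (IHA _) _.
  rewrite trmxX expr2 (expr2 M^T) -mulrA mxtraceX_cycle.
  rewrite (_ : M * (M^T * M^T) * M = (M * M^T) * (M^T * M)); last by rewrite !mulrA.
  apply: le_trans (IHB _ _ (symmxMT M) (symmxTM M)) _.
  have := dot_le_mean ((M * M^T) ^+ (2 ^ k)) ((M^T * M) ^+ (2 ^ k)).
  rewrite !dot_sq [(_ ^+ _)^T](symmxX _ (symmxMT M)).
  rewrite [((M^T * M) ^+ _)^T](symmxX _ (symmxTM M)).
  rewrite -!expr2 -!exprM -!expnSr (mxtraceX_cycle M^T) mulr2n; lra.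
- move=> X Y sX sY.
  have := IHA (X * Y); rewrite trmxM sX sY.
  rewrite [X * Y * _](_ : _ = X * (Y ^+ 2 * X)); last by rewrite expr2 !mulrA.
  move=> /le_trans; apply; rewrite mxtraceX_cycle -mulrA -expr2 mxtraceX_cycle.
  rewrite expnS !exprM; apply: IHB; exact: symmxX.
Qed.

Lemma mxtraceX_mul_le (R : realFieldType) n k (X Y : 'M[R]_n) :
  symmx X -> symmx Y ->
  \tr ((X * Y) ^+ (2 ^ k)) <= \tr (X ^+ (2 ^ k) * Y ^+ (2 ^ k)).
Proof. exact: (mxtraceX_GT R n k).2. Qed.

Lemma opbMr (R : realFieldType) n a b (M N : 'M[R]_n) :
  opb a M -> opb b N -> opb (a * b) (M * N).
Proof. exact: opbM. Qed.

Lemma opbX (R : realFieldType) n a (M : 'M[R]_n) k : opb a M -> opb (a ^+ k) (M ^+ k).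
Proof.
move=> h; elim: k => [|k IH]; first by rewrite !expr0; exact: opb1.
by rewrite !exprS; exact: opbMr.
Qed.

(** Telescoping, one factor at a time. The natural power a^(k-1) is weakened to a^k, which 1 <= a
    allows and which keeps predecessors out of the induction. *)
Lemma opbX_sub (R : realFieldType) n a e (P Q : 'M[R]_n) k :
  1 <= a -> 0 <= e -> opb a P -> opb a Q -> opb e (P - Q) ->
  opb (k%:R * e * a ^+ k) (P ^+ k - Q ^+ k).
Proof.
move=> a1 e0 hP hQ hPQ; have a0 : 0 <= a by exact: le_trans a1.
elim: k => [|k IH]; first by rewrite !expr0 subrr; exact: opb0.
have -> : P ^+ k.+1 - Q ^+ k.+1 = P * (P ^+ k - Q ^+ k) + (P - Q) * Q ^+ k.
  by rewrite !exprS mulrBr mulrBl addrA subrK.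
have ak : 0 <= a ^+ k by rewrite exprn_ge0.
apply: (@opbW _ _ _ (a * (k%:R * e * a ^+ k) + e * a ^+ k)).
- by rewrite addr_ge0 // !mulr_ge0 // ler0n.
- rewrite exprS -natr1 [leRHS](_ : _ = a * (k%:R * e * a ^+ k) + a * (e * a ^+ k)).
    by rewrite lerD2l ler_peMl // mulr_ge0.
  by ring.
- by apply: opbD; [rewrite !mulr_ge0 // ler0n|rewrite mulr_ge0
                  |exact: opbMr|apply: opbMr => //; exact: opbX].
Qed.

Lemma mxtrace_opb (R : realFieldType) n t (M : 'M[R]_n) :
  0 <= t -> opb t M -> \tr M <= n%:R * t.
Proof.
move=> t0 h; rewrite /mxtrace mulr_natl -[X in _ *+ X]card_ord -sumr_const.
apply: ler_sum => i _.
have e1 : dot (delta_mx i 0 : 'cV[R]_n) (delta_mx i 0) = 1.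
  by rewrite /dot trmx_delta mul_delta_mx /mxtrace big_ord1 mxE.
have -> : M i i = dot (delta_mx i 0 : 'cV[R]_n) (M *m delta_mx i 0).
  rewrite /dot trmx_delta mulmxA -rowE -colE /mxtrace big_ord1.
  by rewrite !mxE.
rewrite -[leRHS]mul1r; apply: dot_scale_le => //; first by rewrite e1 expr1n.
by apply: le_trans (h _) _; rewrite e1 mulr1.
Qed.

(* A polynomial substitute for the matrix exponential: no spectral theorem is
   needed to handle it. *)
Definition expK (R : realFieldType) (n K : nat) (A : 'M[R]_n) : 'M[R]_n :=
  (1 + K%:R^-1 *: A) ^+ K.

Lemma symmx1DZ (R : realFieldType) n c (A : 'M[R]_n) :
  symmx A -> symmx (1 + c *: A).
Proof. by rewrite /symmx => h; rewrite linearD linearZ /= h trmx1. Qed.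

Lemma opb1DZ (R : realFieldType) n a c (A : 'M[R]_n) :
  0 <= a -> 0 <= c -> opb a A -> opb (1 + c * a) (1 + c *: A).
Proof.
by move=> a0 c0 h; apply: opbD; rewrite ?mulr_ge0 //; [exact: opb1|exact: opbZ].
Qed.

(** (1 + A/K)(1 + B/K) differs from 1 + (A + B)/K only by A B / K^2, and taking K-th powers
    multiplies this by K times a bounded factor. The substitute for Golden-Thompson thus holds up to
    an error of order 1/K. *)
Lemma mxtrace_expK_add (R : realFieldType) n k a b (A B : 'M[R]_n) (K := (2 ^ k)%N) :
  0 <= a -> 0 <= b -> symmx A -> symmx B -> opb a A -> opb b B ->
  \tr (expK K (A + B)) <= \tr (expK K A * expK K B) +
    n%:R * (a * b / K%:R * ((1 + K%:R^-1 * a) * (1 + K%:R^-1 * b)) ^+ K).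
Proof.
move=> a0 b0 sA sB hA hB; set c := K%:R^-1.
have K0 : (K%:R : R) != 0 by rewrite pnatr_eq0 /K -lt0n expn_gt0.
have c0 : 0 <= c by rewrite invr_ge0 ler0n.
have ca : 0 <= c * a by rewrite mulr_ge0.
have cb : 0 <= c * b by rewrite mulr_ge0.
have := mxtraceX_mul_le k (symmx1DZ c sA) (symmx1DZ c sB); rewrite -/K => gt.
apply: le_trans (lerD gt (lexx _)); rewrite -lerBlDl -linearB.
set P := 1 + c *: A; set Q := 1 + c *: B.
have hPQ : opb ((1 + c * a) * (1 + c * b)) (P * Q).
  by apply: opbMr; apply: opb1DZ.
have e : 1 + c *: (A + B) - P * Q = - (c *: A * (c *: B)).
  have -> : P * Q = (1 + c *: (A + B)) + c *: A * (c *: B).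
    by rewrite mulrDl mul1r mulrDr mulr1 scalerDr !addrA (addrAC 1).
  by rewrite opprD addrA subrr add0r.
set t := _ * _ ^+ _; have t0 : 0 <= t.
  by rewrite /t !mulr_ge0 ?exprn_ge0 ?mulr_ge0 ?invr_ge0 ?ler0n // addr_ge0.
apply: mxtrace_opb => //.
have -> : t = K%:R * (c * a * (c * b)) * ((1 + c * a) * (1 + c * b)) ^+ K.
  by rewrite /t /c; congr (_ * _); field.
apply: opbX_sub => //; first by nra.
- exact: mulr_ge0.
- apply: (@opbW _ _ _ (1 + c * (a + b))); [|nra|apply: opb1DZ => //].
  + by rewrite addr_ge0 // mulr_ge0 // addr_ge0.
  + exact: addr_ge0.
  + exact: opbD.
- by rewrite e; apply: opbN; apply: opbMr; exact: opbZ.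
Qed.

(** The remainder is kept between two factors [B]: for symmetric [B], <Y, B H B Y> = <B Y, H B Y>,
    so it can be charged to the second moment |B Y|^2. *)
Lemma expX_quad (R : realFieldType) n (B : 'M[R]_n) (c : R) k :
  0 <= c -> opb 1 B ->
  exists2 H : 'M[R]_n, opb ((k%:R * c) ^+ 2 * (1 + c) ^+ k) H &
    (1 + c *: B) ^+ k = 1 + (k%:R * c) *: B + B * H * B.
Proof.
move=> c0 hB; elim: k => [|k [H hH e]].
  exists 0; first exact: opb0.
  by rewrite expr0 mul0r scale0r mulr0 mul0r !addr0.
have c1 : 1 <= 1 + c by rewrite lerDl.
have k0 : 0 <= k%:R :> R by rewrite ler0n.
have ck : 1 <= (1 + c) ^+ k by rewrite exprn_ege1.
have h0 : 0 <= (k%:R * c) ^+ 2 * (1 + c) ^+ k.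
  by rewrite mulr_ge0 ?sqr_ge0 // (le_trans ler01).
(* Multiplying the expansion by 1 + c B turns the quadratic part into k c^2 B^2 + B H B + c B (B H
   B); the witness is what stands between the outer factors [B]. *)
exists ((k%:R * c ^+ 2) *: (1 : 'M[R]_n) + (1 + c *: B) * H).
  apply: (@opbW _ _ _ (k%:R * c ^+ 2 * 1 + (1 + c * 1) * ((k%:R * c) ^+ 2 * (1 + c) ^+ k))).
  - by rewrite mulr1 addr_ge0 // mulr_ge0 // ?mulr1 ?sqr_ge0 // addr_ge0.
  - rewrite !mulr1 [(1 + c) ^+ k.+1]exprS -natr1.
    have : 1 <= (1 + c) * (1 + c) ^+ k by nra.
    have : 0 <= k%:R * c ^+ 2 by rewrite mulr_ge0 ?sqr_ge0.
    have : 0 <= c ^+ 2 by exact: sqr_ge0.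
    set E := (1 + c) ^+ k; move=> c2 kc2 X1.
    have h1 : 0 <= k%:R * c ^+ 2 * ((1 + c) * E - 1) by rewrite mulr_ge0 // subr_ge0.
    have h2 : 0 <= (k%:R * c ^+ 2 + c ^+ 2) * ((1 + c) * E).
      by apply: mulr_ge0; [exact: addr_ge0|exact: le_trans X1].
    nra.
  - apply: opbD; rewrite ?mulr1 ?mulr_ge0 ?sqr_ge0 ?addr_ge0 //.
    + exact: le_trans ck.
    + rewrite -[X in @opb _ _ _ X _]mulr1; apply: opbZ; exact: opb1.
    + apply: opbMr => //; rewrite -[X in 1 + X]mulr1; exact: opb1DZ.
have -> : B * ((k%:R * c ^+ 2) *: (1 : 'M[R]_n) + (1 + c *: B) * H) * B =
    (k%:R * c ^+ 2) *: (B * B) + B * H * B + c *: B * (B * H * B).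
  rewrite mulrDr mulrDl scalemxMr mulr1 scalemxMl -addrA; congr (_ + _).
  rewrite mulrDl mul1r mulrDr mulrDl; congr (_ + _).
  by rewrite !scalemxMl !scalemxMr !scalemxMl !mulrA.
rewrite exprS e mulrDl mul1r -natr1 mulrDl mul1r scalerDl.
rewrite [c *: B * _]mulrDr [c *: B * (1 + _)]mulrDr mulr1 scalemxMl scalemxMr scalerA.
rewrite (_ : c * (k%:R * c) = k%:R * c ^+ 2); last by rewrite expr2; ring.
set x := _ *: B; set y := c *: B; set z := _ *: (B * B).
set w := B * H * B; set v := c *: B * w.
rewrite -!addrA; congr (1 + (x + _)).
by rewrite addrCA; congr (_ + _); exact: addrCA.
Qed.

(** * Independent samples *)

Definition avg (R : realType) (T : finType) (f : T -> R) : R :=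
  #|T|%:R^-1 * \sum_t f t.

(* Expectation over [q] independent uniform samples from [T]. *)
Fixpoint Eseq (R : realType) (T : finType) (q : nat) (f : seq T -> R) : R :=
  if q is q'.+1 then avg (fun t => Eseq q' (fun s => f (t :: s))) else f [::].

Definition Pseq (R : realType) (T : finType) (q : nat) (P : seq T -> Prop) : R :=
  Eseq q (fun s => (`[< P s >] : nat)%:R).

Lemma avg_le (R : realType) (T : finType) (f g : T -> R) :
  (forall t, f t <= g t) -> avg f <= avg g.
Proof.
by move=> h; rewrite /avg ler_wpM2l ?invr_ge0 ?ler0n //; apply: ler_sum.
Qed.

Lemma eq_avg (R : realType) (T : finType) (f g : T -> R) : f =1 g -> avg f = avg g.
Proof. by move=> h; rewrite /avg (eq_bigr g). Qed.

Lemma avgD (R : realType) (T : finType) (f g : T -> R) :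
  avg (fun t => f t + g t) = avg f + avg g.
Proof. by rewrite /avg big_split mulrDr. Qed.

Lemma avgZ (R : realType) (T : finType) a (f : T -> R) :
  avg (fun t => a * f t) = a * avg f.
Proof. by rewrite /avg -mulr_sumr mulrCA. Qed.

Lemma avg_cst (R : realType) (T : finType) (a : R) :
  (0 < #|T|)%N -> avg (fun _ : T => a) = a.
Proof.
by move=> T0; rewrite /avg sumr_const -[X in _ * X]mulr_natl mulrA mulVf ?mul1r // pnatr_eq0 -lt0n.
Qed.

Lemma avg_sum (R : realType) (T : finType) (I : Type) (r : seq I) (F : I -> T -> R) :
  avg (fun t => \sum_(i <- r) F i t) = \sum_(i <- r) avg (F i).
Proof. by rewrite /avg exchange_big mulr_sumr. Qed.

Lemma Eseq_le (R : realType) (T : finType) q (f g : seq T -> R) :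
  (forall s, size s = q -> f s <= g s) -> Eseq q f <= Eseq q g.
Proof.
elim: q f g => [|q IH] f g h /=; first exact: h.
by apply: avg_le => t; apply: IH => s hs; apply: h; rewrite /= hs.
Qed.

Lemma eq_Eseq (R : realType) (T : finType) q (f g : seq T -> R) :
  (forall s, size s = q -> f s = g s) -> Eseq q f = Eseq q g.
Proof.
by move=> h; apply/eqP; rewrite eq_le !Eseq_le // => s /h ->.
Qed.

Lemma EseqD (R : realType) (T : finType) q (f g : seq T -> R) :
  Eseq q (fun s => f s + g s) = Eseq q f + Eseq q g.
Proof.
elim: q f g => [//|q IH] f g /=; rewrite -avgD.
by apply: eq_avg => t; rewrite IH.
Qed.

Lemma EseqZ (R : realType) (T : finType) q a (f : seq T -> R) :
  Eseq q (fun s => a * f s) = a * Eseq q f.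
Proof.
elim: q f => [//|q IH] f /=; rewrite -avgZ.
by apply: eq_avg => t; rewrite IH.
Qed.

Lemma Eseq_cst (R : realType) (T : finType) q (a : R) :
  (0 < #|T|)%N -> Eseq q (fun _ : seq T => a) = a.
Proof.
move=> T0; elim: q => [//|q IH] /=; rewrite -[RHS](avg_cst _ T0).
exact: eq_avg.
Qed.

Lemma Eseq_cat (R : realType) (T : finType) p q (f : seq T -> R) :
  Eseq (p + q) f = Eseq p (fun s => Eseq q (fun s' => f (s ++ s'))).
Proof. by elim: p f => [//|p IH] f /=; apply: eq_avg => t; rewrite IH. Qed.

Lemma Pseq_le (R : realType) (T : finType) q (P Q : seq T -> Prop) :
  (forall s, size s = q -> P s -> Q s) -> Pseq R q P <= Pseq R q Q.
Proof.
move=> h; apply: Eseq_le => s hs; rewrite ler_nat.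
by case: asboolP => // hP; rewrite asboolT //; exact: h.
Qed.

Lemma Pseq_and (R : realType) (T : finType) q (P Q : seq T -> Prop) (a b : R) :
  (0 < #|T|)%N -> 1 - a <= Pseq R q P -> 1 - b <= Pseq R q Q ->
  1 - (a + b) <= Pseq R q (fun s => P s /\ Q s).
Proof.
move=> T0 hP hQ.
apply: le_trans (_ : Pseq R q P + Pseq R q Q + -1 <= _); first by lra.
rewrite -(Eseq_cst q (-1) T0) -!EseqD; apply: Eseq_le => s _.
case: (asboolP (P s)) => hp; case: (asboolP (Q s)) => hq.
- by rewrite asboolT //=; lra.
- by rewrite asboolF ?addr0 ?subrr //; case.
- by rewrite asboolF ?add0r ?subrr //; case.
- by rewrite asboolF; [rewrite /=; lra|case].
Qed.

Lemma Pseq_forall (R : realType) (T : finType) q (I : finType)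
    (P : I -> seq T -> Prop) (a : R) :
  (0 < #|T|)%N -> (forall i, 1 - a <= Pseq R q (P i)) ->
  1 - #|I|%:R * a <= Pseq R q (fun s => forall i, P i s).
Proof.
move=> T0 h.
apply: le_trans (_ : Pseq R q (fun s => forall i, i \in enum I -> P i s) <= _);
  last by apply: Pseq_le => s _ hs i; apply: hs; rewrite mem_enum.
rewrite cardE; elim: (enum I) => [|i r IH].
  rewrite mul0r subr0 -{1}(Eseq_cst q 1 T0); apply: Eseq_le => s _.
  by rewrite asboolT.
rewrite /= -natr1 mulrDl mul1r [_ * a + a]addrC.
apply: le_trans (Pseq_and T0 (h i) IH) _; apply: Pseq_le => s _ [hi hr] j.
by rewrite in_cons => /orP [/eqP ->|/hr].
Qed.

(** Conditioning on the first [p] samples. [Q] may depend on them, which lets every batch aim at the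
    residual left by the earlier ones. *)
Lemma Pseq_cat (R : realType) (T : finType) p q (P : seq T -> Prop)
    (Q : seq T -> seq T -> Prop) (S : seq T -> Prop) (a b : R) :
  (0 < #|T|)%N -> 0 <= b -> 1 - a <= Pseq R p P ->
  (forall s, P s -> 1 - b <= Pseq R q (Q s)) ->
  (forall s s', P s -> Q s s' -> S (s ++ s')) ->
  1 - (a + b) <= Pseq R (p + q) S.
Proof.
move=> T0 b0 hP hQ hS; rewrite /Pseq Eseq_cat.
apply: le_trans (_ : Pseq R p P + - b <= _); first by lra.
rewrite -(Eseq_cst p (-b) T0) -EseqD; apply: Eseq_le => s _.
case: asboolP => hp /=.
  apply: le_trans (hQ s hp) _; apply: Eseq_le => s' _; rewrite ler_nat.
  by case: asboolP => // hq; rewrite asboolT //; exact: hS.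
apply: le_trans (_ : 0 <= _); first lra.
rewrite -(Eseq_cst q 0 T0); apply: Eseq_le => s' _; exact: ler0n.
Qed.

Lemma Pseq_markov (R : realType) (T : finType) q (P : seq T -> Prop)
    (f : seq T -> R) (a : R) :
  (0 < #|T|)%N -> 0 < a -> (forall s, 0 <= f s) ->
  (forall s, ~ P s -> a <= f s) ->
  1 - a^-1 * Eseq q f <= Pseq R q P.
Proof.
move=> T0 a0 f0 h; rewrite -EseqZ -{1}(Eseq_cst q 1 T0).
rewrite lerBlDr -EseqD; apply: Eseq_le => s _.
case: asboolP => hp /=.
  by rewrite lerDl mulr_ge0 // invr_ge0 ltW.
by rewrite add0r ler_pdivlMl // mulr1; exact: h.
Qed.

Lemma opb_dot (R : realFieldType) m p t (M : 'M[R]_m) (Y : 'M[R]_(m, p)) :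
  0 <= t -> opb t M -> dot Y (M *m Y) <= t * dot Y Y.
Proof.
move=> t0 h; have h1 := opb_mx Y h; have y0 := dot_ge0 Y.
have cs := cauchy_schwarz Y (M *m Y).
have [d|/ltW d] := leP 0 (dot Y (M *m Y)); last exact: le_trans d (mulr_ge0 t0 y0).
rewrite -(@ler_pXn2r _ 2) // ?nnegrE ?mulr_ge0 //; nra.
Qed.

(** * Scalar estimates comparing (1 + x/K)^K with the exponential *)

Lemma expR1_le4 (R : realType) : expR 1 <= 4 :> R.
Proof.
have h := expR_ge1Dx (- 2^-1 : R).
have g := expR_gt0 (2^-1 : R); rewrite expRN in h.
have : expR 2^-1 <= 2 :> R.
  by rewrite -lef_pV2 ?posrE //; apply: le_trans h; lra.
rewrite (_ : expR 1 = expR (2^-1 + 2^-1)); last by congr expR; lra.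
rewrite expRD; nra.
Qed.

Lemma expr1Ddiv_le (R : realType) (x : R) K :
  0 <= x -> (1 + K%:R^-1 * x) ^+ K <= expR x.
Proof.
move=> x0; case: K => [|K]; first by rewrite expr0; have := expR_ge1Dx x; lra.
have -> : expR x = expR (K.+1%:R^-1 * x) ^+ K.+1.
  by rewrite -expRM_natl mulrA mulfV ?mul1r // pnatr_eq0.
apply: lerXn2r; rewrite ?nnegrE ?expR_ge0 ?expR_ge1Dx //.
by rewrite addr_ge0 // mulr_ge0 // invr_ge0.
Qed.

(** Reduces to exp (y/2) <= 1 + y on [0, 1], which follows from exp (-y/2) >= 1 - y/2 and (1 + y)(1
    - y/2) >= 1. The factor 2 lost here is the [t / 2] of the Bernstein exponent. *)
Lemma expr1Ddiv_ge (R : realType) (x : R) K :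
  0 <= x -> x <= K%:R -> expR (x / 2) <= (1 + K%:R^-1 * x) ^+ K.
Proof.
move=> x0 xK; case: K xK => [|K] xK.
  have -> : x = 0 by apply/le_anti; rewrite x0 andbT.
  by rewrite mul0r expR0 expr0.
have K0 : (0 : R) < K.+1%:R by rewrite ltr0n.
have -> : expR (x / 2) = expR (K.+1%:R^-1 * x / 2) ^+ K.+1.
  by rewrite -expRM_natl !mulrA mulfV ?mul1r // pnatr_eq0.
set y := K.+1%:R^-1 * x.
have y0 : 0 <= y by rewrite mulr_ge0 // invr_ge0.
have y1 : y <= 1 by rewrite ler_pdivrMl // mulr1.
apply: lerXn2r; rewrite ?nnegrE ?expR_ge0 ?addr_ge0 //.
have := expR_ge1Dx (- (y / 2)); rewrite expRN => h.
have g := expR_gt0 (y / 2).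
have h2 : (1 - y / 2) * expR (y / 2) <= 1.
  by rewrite -ler_pdivlMr // div1r; lra.
nra.
Qed.

(** * Matrix Bernstein inequality *)

(** The quadratic-form version of exp B <= 1 + B + 4 B^2; the 4 comes from (1 + 1/K)^K <= e <= 4. *)
Lemma dot_expK_le (R : realType) n p K (B : 'M[R]_n) (Y : 'M[R]_(n, p)) :
  (0 < K)%N -> symmx B -> opb 1 B ->
  dot Y (expK K B *m Y) <= dot Y Y + dot Y (B *m Y) + 4 * dot (B *m Y) (B *m Y).
Proof.
move=> K0 sB hB; have c0 : 0 <= K%:R^-1 :> R by rewrite invr_ge0.
have [H hH e] := expX_quad K c0 hB.
have kc : K%:R * K%:R^-1 = 1 :> R by rewrite mulfV // pnatr_eq0 -lt0n.
rewrite kc expr1n mul1r in hH; rewrite /expK e kc scale1r -!mulmxE.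
rewrite !mulmxDl mul1mx !dotDr lerD2l -!mulmxA dot_mull sB.
apply: opb_dot => //; apply: opbW hH; first by rewrite exprn_ge0 // addr_ge0.
have := expr1Ddiv_le K (@ler01 R); rewrite mulr1 => /le_trans; apply.
exact: expR1_le4.
Qed.

Lemma avg_dot_le (R : realType) (T : finType) m n p (B : T -> 'M[R]_(m, n)) v
    (Y : 'M[R]_(n, p)) :
  (forall x : 'cV[R]_n, avg (fun t => dot (B t *m x) (B t *m x)) <= v * dot x x) ->
  avg (fun t => dot (B t *m Y) (B t *m Y)) <= v * dot Y Y.
Proof.
move=> h; rewrite (dot_col Y Y) mulr_sumr.
rewrite (@eq_avg _ _ _ (fun t => \sum_j dot (B t *m col j Y) (B t *m col j Y))).
  by rewrite avg_sum; apply: ler_sum.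
by move=> t; rewrite dot_col; apply: eq_bigr => j _; rewrite !colE mulmxA.
Qed.

(** For symmetric [A] the even exponent exhibits [expK] as N N with N symmetric. Its trace is then
    |N|^2, and tr (N N C) is the quadratic form <N, C N>, so bounds on the form of C can be used
    under the trace. *)
Lemma expK_sqr (R : realType) n k (A : 'M[R]_n) :
  expK (2 ^ k.+1) A =
  (1 + (2 ^ k.+1)%:R^-1 *: A) ^+ (2 ^ k) * (1 + (2 ^ k.+1)%:R^-1 *: A) ^+ (2 ^ k).
Proof. by rewrite /expK -exprD addnn -mul2n -expnS. Qed.

Lemma avg_mxtrace_expK_mul (R : realType) (T : finType) n k (A : 'M[R]_n)
    (B : T -> 'M[R]_n) v :
  (0 < #|T|)%N -> symmx A -> (forall t, symmx (B t)) -> (forall t, opb 1 (B t)) ->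
  \sum_t B t = 0 ->
  (forall x : 'cV[R]_n, avg (fun t => dot (B t *m x) (B t *m x)) <= v * dot x x) ->
  avg (fun t => \tr (expK (2 ^ k.+1) A * expK (2 ^ k.+1) (B t))) <=
  (1 + 4 * v) * \tr (expK (2 ^ k.+1) A).
Proof.
move=> T0 sA sB hB B0 hv; set K := (2 ^ k.+1)%N.
rewrite expK_sqr -/K; set N := _ ^+ _.
have sN : N^T = N by apply: symmxX; exact: symmx1DZ.
have -> : \tr (N * N) = dot N N by rewrite /dot sN.
apply: le_trans (_ : avg (fun t => dot N N + dot N (B t *m N) +
    4 * dot (B t *m N) (B t *m N)) <= _).
  have K0 : (0 < K)%N by rewrite expn_gt0.
  apply: avg_le => t; apply: le_trans (dot_expK_le N K0 (sB t) (hB t)).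
  by rewrite -mulrA mxtrace_mulrC -mulrA /dot sN.
rewrite !avgD avgZ avg_cst //.
have -> : avg (fun t => dot N (B t *m N)) = 0.
  by rewrite /avg -dot_sumr -mulmx_suml B0 mul0mx dot0r mulr0.
have := avg_dot_le N hv; lra.
Qed.

Lemma avg_mxtrace_expK_add (R : realType) (T : finType) n k (A : 'M[R]_n)
    (B : T -> 'M[R]_n) v a (K := (2 ^ k.+1)%N) :
  (0 < #|T|)%N -> symmx A -> (forall t, symmx (B t)) -> (forall t, opb 1 (B t)) ->
  \sum_t B t = 0 -> 0 <= a -> opb a A ->
  (forall x : 'cV[R]_n, avg (fun t => dot (B t *m x) (B t *m x)) <= v * dot x x) ->
  avg (fun t => \tr (expK K (A + B t))) <=
  (1 + 4 * v) * \tr (expK K A) + n%:R * (a * expR (a + 1)) / K%:R.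
Proof.
move=> T0 sA sB hB B0 a0 hA hv.
have K0 : (0 : R) < K%:R by rewrite ltr0n expn_gt0.
apply: le_trans (_ : avg (fun t => \tr (expK K A * expK K (B t)) +
    n%:R * (a * expR (a + 1)) / K%:R) <= _); last first.
  by rewrite avgD avg_cst // lerD2r; exact: avg_mxtrace_expK_mul.
apply: avg_le => t.
apply: le_trans (mxtrace_expK_add k.+1 a0 ler01 sA (sB t) hA (hB t)) _.
rewrite lerD2l -/K mulr1.
have -> : n%:R * (a * expR (a + 1)) / K%:R = n%:R * (a / K%:R * expR (a + 1)) by ring.
rewrite ler_wpM2l // ler_wpM2l ?divr_ge0 // exprMn expRD.
have c0 : 0 <= K%:R^-1 :> R by rewrite invr_ge0 ltW.
by apply: ler_pM; rewrite ?expr1Ddiv_le ?exprn_ge0 ?addr_ge0 ?mulr_ge0 //.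
Qed.

(** [A] stands for the sum of the samples already drawn and [a] for their number, which bounds its
    norm because each sample has norm at most 1. Replacing [a] by [Q] makes the splitting error the
    same at every draw. *)
Lemma Eseq_mxtrace_expK (R : realType) (T : finType) n k (B : T -> 'M[R]_n) v
    (Q : nat) q a (A : 'M[R]_n) (K := (2 ^ k.+1)%N) :
  (0 < #|T|)%N -> (forall t, symmx (B t)) -> (forall t, opb 1 (B t)) ->
  \sum_t B t = 0 -> 0 <= v ->
  (forall x : 'cV[R]_n, avg (fun t => dot (B t *m x) (B t *m x)) <= v * dot x x) ->
  symmx A -> opb a%:R A -> (a + q <= Q)%N ->
  Eseq q (fun s => \tr (expK K (A + \sum_(t <- s) B t))) <=
  (1 + 4 * v) ^+ q *
    (\tr (expK K A) + q%:R * (n%:R * (Q%:R * expR (Q%:R + 1)) / K%:R)).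
Proof.
move=> T0 sB hB B0 v0 hv; set C := n%:R * _ / _.
have K0 : (0 : R) < K%:R by rewrite ltr0n expn_gt0.
have w1 : 1 <= 1 + 4 * v by rewrite lerDl mulr_ge0.
have w0 : 0 <= 1 + 4 * v by exact: le_trans w1.
have C0 : 0 <= C by rewrite /C divr_ge0 ?mulr_ge0 ?expR_ge0 ?ler0n.
elim: q a A => [|q IH] a A sA hA aq /=.
  by rewrite big_nil expr0 mul0r !addr0 mul1r.
apply: le_trans (_ : avg (fun t => (1 + 4 * v) ^+ q *
    (\tr (expK K (A + B t)) + q%:R * C)) <= _).
  apply: avg_le => t.
  rewrite (@eq_Eseq _ _ _ _ (fun s => \tr (expK K ((A + B t) + \sum_(t <- s) B t)))).
    apply: (IH a.+1).
    - by rewrite /symmx linearD /= sA sB.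
    - by rewrite -natr1; apply: opbD.
    - by rewrite addSnnS.
  by move=> s _; rewrite big_cons addrA.
rewrite avgZ avgD avg_cst // exprSr -mulrA ler_wpM2l ?exprn_ge0 //.
have h := avg_mxtrace_expK_add k T0 sA sB hB B0 (ler0n R a) hA hv.
have hC : n%:R * (a%:R * expR (a%:R + 1)) / K%:R <= C.
  rewrite /C ler_wpM2r ?invr_ge0 ?(ltW K0) //; apply: ler_wpM2l => //.
  have aQ : (a%:R : R) <= Q%:R by rewrite ler_nat; lia.
  by apply: ler_pM; rewrite ?expR_ge0 // ler_expR lerD2r.
have vC : 0 <= 4 * v * ((q%:R + 1) * C) by apply: mulr_ge0; [exact: mulr_ge0|apply: mulr_ge0 => //; exact: addr_ge0].
rewrite -/K in h; rewrite -natr1; lra.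
Qed.

(** One vector replaces the top eigenvalue. For symmetric M, Cauchy-Schwarz gives <x, M x>^2 <=
    |x|^2 <x, M^2 x>, so a Rayleigh quotient of at least b becomes one of at least b^(2^j) for
    M^(2^j). Finally <x, N N x> = |N x|^2 <= tr (N N) |x|^2. *)
Lemma mxtrace_expK_ge (R : realType) n k (S : 'M[R]_n) t (x : 'cV[R]_n)
    (K := (2 ^ k.+1)%N) :
  symmx S -> 0 <= t -> t <= K%:R -> t * dot x x < dot x (S *m x) ->
  expR (t / 2) <= \tr (expK K S).
Proof.
move=> sS t0 tK hx.
have x0 : 0 < dot x x.
  by apply: dot_gt0; apply: contraTneq hx => ->; rewrite mulmx0 !dot0r mulr0 ltxx.
apply: le_trans (expr1Ddiv_ge t0 tK) _.
have K0 : (0 : R) < K%:R by rewrite ltr0n expn_gt0.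
set b := 1 + _; set M := 1 + K%:R^-1 *: S.
have b0 : 0 <= b by rewrite addr_ge0 // mulr_ge0 // invr_ge0 ltW.
have sM : symmx M by exact: symmx1DZ.
have hM : b * dot x x <= dot x (M *m x).
  rewrite mulmxDl mul1mx dotDr mulrDl mul1r lerD2l -scalemxAl dotZr -mulrA.
  by rewrite ler_wpM2l ?invr_ge0 // ltW.
have step j : b ^+ (2 ^ j) * dot x x <= dot x (M ^+ (2 ^ j) *m x).
  elim: j => [|j IH]; first by rewrite !expr1.
  have bj : 0 <= b ^+ (2 ^ j) * dot x x by rewrite mulr_ge0 ?exprn_ge0 // ltW.
  have cs := cauchy_schwarz x (M ^+ (2 ^ j) *m x).
  rewrite -(ler_pM2l x0) expnS mul2n -addnn !exprD -mulmxE -mulmxA.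
  rewrite [X in _ <= _ * X]dot_mull (symmxX _ sM).
  apply: le_trans cs; apply: le_trans (_ : (b ^+ (2 ^ j) * dot x x) ^+ 2 <= _).
    by rewrite expr2 le_eqVlt; apply/orP; left; apply/eqP; ring.
  by apply: lerXn2r; rewrite ?nnegrE // (le_trans bj).
rewrite -(ler_pM2r x0); apply: le_trans (step k.+1) _.
rewrite -/K -[M ^+ K]/(expK K S) expK_sqr -/K -/M.
set N := M ^+ _; have sN : N^T = N by exact: symmxX.
rewrite -mulmxE -mulmxA dot_mull sN.
have -> : \tr (N *m N) = dot N N by rewrite /dot sN.
exact: dot_mulmx_le.
Qed.

Lemma symmx_sum (R : realFieldType) (I : Type) (r : seq I) n (F : I -> 'M[R]_n) :
  (forall i, symmx (F i)) -> symmx (\sum_(i <- r) F i).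
Proof.
by move=> h; rewrite /symmx linear_sum /=; apply: eq_bigr => i _; exact: h.
Qed.

Lemma exists_pow2_ge (R : realType) (x : R) : exists k, x <= (2 ^ k.+1)%:R.
Proof.
exists (Num.bound `|x|); have := ltW (archi_boundP (normr_ge0 x)).
move=> h; apply: le_trans (ler_norm x) _.
apply: le_trans h _; rewrite ler_nat -ltnS; apply: ltn_trans (ltn_expl _ (ltnSn 1)) _.
by rewrite ltnS leq_exp2l.
Qed.

Lemma matrix_bernstein (R : realType) (T : finType) n (B : T -> 'M[R]_n) (v t : R) q :
  (0 < #|T|)%N -> (forall t, symmx (B t)) -> (forall t, opb 1 (B t)) ->
  \sum_t B t = 0 -> 0 <= v -> 0 <= t ->
  (forall x : 'cV[R]_n, avg (fun t => dot (B t *m x) (B t *m x)) <= v * dot x x) ->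
  1 - 2 * n%:R * expR (4 * v * q%:R - t / 2) <=
  Pseq R q (fun s => forall x : 'cV[R]_n,
    dot x ((\sum_(t <- s) B t) *m x) <= t * dot x x).
Proof.
move=> T0 sB hB B0 v0 t0 hv.
set C : R := q%:R * (q%:R * expR (q%:R + 1)).
have C0 : 0 <= C by rewrite /C !mulr_ge0 ?expR_ge0.
(* K >= t is what the lower bound on the trace requires. K >= C makes the accumulated splitting
   error at most [n]; added to the initial trace, which is also [n], it produces the factor 2 n. *)
have [k hk] := exists_pow2_ge (t + C); set K := (2 ^ k.+1)%N in hk.
have K0 : (0 : R) < K%:R by rewrite ltr0n expn_gt0.
pose f (s : seq T) := \tr (expK K (\sum_(t <- s) B t)).
have f0 s : 0 <= f s.
  rewrite /f /K expK_sqr; set N := _ ^+ _.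
  have sN : N^T = N by apply: symmxX; apply: symmx1DZ; exact: symmx_sum.
  have -> : \tr (N * N) = dot N N by rewrite /dot sN.
  exact: dot_ge0.
have := @Pseq_markov R T q (fun s => forall x : 'cV[R]_n,
    dot x ((\sum_(t <- s) B t) *m x) <= t * dot x x) f (expR (t / 2)) T0
    (expR_gt0 _) f0.
move=> h; apply: le_trans (h _); last first.
  move=> s /existsNP [x /negP]; rewrite -ltNge => hx.
  by apply: (mxtrace_expK_ge _ t0 _ hx); [exact: symmx_sum|lra].
rewrite lerD2l lerN2 expRD expRN.
have e := @Eseq_mxtrace_expK R T n k B v q q 0 0 T0 sB hB B0 v0 hv.
have {}e := e (trmx0 _ _ _) (@opb0 _ _ _ _) (leqnn _).
rewrite (@eq_Eseq _ _ _ _ f) in e; last by move=> s _; rewrite add0r.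
rewrite [leLHS]mulrC [leRHS]mulrA ler_wpM2r ?invr_ge0 ?expR_ge0 //.
apply: le_trans e _; rewrite [leLHS]mulrC.
have tr1 : \tr (expK K (0 : 'M[R]_n)) = n%:R.
  by rewrite /expK scaler0 addr0 expr1n mxtrace1.
rewrite -/K tr1; apply: ler_pM; rewrite ?exprn_ge0 //.
- by rewrite addr_ge0 // !mulr_ge0 ?expR_ge0 ?invr_ge0 // ltW.
- by rewrite addr_ge0 // mulr_ge0.
- have -> : q%:R * (n%:R * (q%:R * expR (q%:R + 1)) / K%:R) = n%:R * (C / K%:R).
    by rewrite /C; ring.
  have : n%:R * (C / K%:R) <= n%:R * 1 :> R.
    by rewrite ler_wpM2l // ler_pdivrMr // mul1r; lra.
  lra.
- rewrite expRM_natr; apply: lerXn2r; rewrite ?nnegrE ?expR_ge0 //.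
    by rewrite addr_ge0 // mulr_ge0.
  exact: expR_ge1Dx.
Qed.

(** * Rectangular matrices through their symmetric dilations *)

Definition dilation (R : realFieldType) m n (M : 'M[R]_(m, n)) : 'M[R]_(m + n) :=
  block_mx 0 M M^T 0.

Lemma dilation_sym (R : realFieldType) m n (M : 'M[R]_(m, n)) : symmx (dilation M).
Proof. by rewrite /symmx /dilation tr_block_mx !trmx0 trmxK. Qed.

Lemma dilation0 (R : realFieldType) m n : dilation (0 : 'M[R]_(m, n)) = 0.
Proof. by rewrite /dilation trmx0 block_mx_const. Qed.

Lemma dilation_sum (R : realFieldType) (I : Type) (r : seq I) m n
    (F : I -> 'M[R]_(m, n)) :
  dilation (\sum_(i <- r) F i) = \sum_(i <- r) dilation (F i).
Proof.
elim: r => [|i r IH]; first by rewrite !big_nil dilation0.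
by rewrite !big_cons -IH /dilation linearD /= add_block_mx !addr0.
Qed.

Lemma dilationZ (R : realFieldType) m n c (M : 'M[R]_(m, n)) :
  dilation (c *: M) = c *: dilation M.
Proof. by rewrite /dilation scale_block_mx !scaler0 linearZ. Qed.

Lemma dot_col_mx (R : realFieldType) m n p (A C : 'M[R]_(m, p)) (B D : 'M[R]_(n, p)) :
  dot (col_mx A B) (col_mx C D) = dot A C + dot B D.
Proof. by rewrite /dot tr_col_mx mul_row_col linearD. Qed.

Lemma mul_dilation (R : realFieldType) m n (M : 'M[R]_(m, n)) (x : 'cV[R]_m) y :
  dilation M *m col_mx x y = col_mx (M *m y) (M^T *m x).
Proof. by rewrite /dilation mul_block_col !mul0mx add0r addr0. Qed.

Lemma opb_dilation (R : realFieldType) m n t (M : 'M[R]_(m, n)) :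
  opb t M -> opb t (dilation M).
Proof.
move=> h x; rewrite -(vsubmxK x) mul_dilation !dot_col_mx mulrDr addrC.
by apply: lerD; [exact: (opb_trmx h)|exact: h].
Qed.

(** A one-sided bound on the quadratic form suffices: at the vector (M y / t, y) it reads 2 |M y|^2
    / t <= |M y|^2 / t + t |y|^2. *)
Lemma dilation_opb (R : realFieldType) m n (t : R) (M : 'M[R]_(m, n)) :
  0 < t -> (forall x : 'cV[R]_(m + n), dot x (dilation M *m x) <= t * dot x x) -> opb t M.
Proof.
move=> t0 h y; have := h (col_mx (t^-1 *: (M *m y)) y).
rewrite mul_dilation !dot_col_mx !dotZl !dotZr -!scalemxAr dotZr (dot_mull M^T) trmxK.
set a := dot (M *m y) (M *m y); rewrite -(ler_pM2l t0).
have tt : t * t^-1 = 1 by rewrite mulfV ?gt_eqF.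
have -> : t * (t^-1 * a + t^-1 * a) = (t * t^-1) * (a + a) by ring.
have -> : t * (t * (t^-1 * (t^-1 * a) + dot y y)) =
  (t * t^-1) * (t * t^-1) * a + t ^+ 2 * dot y y by ring.
rewrite tt; lra.
Qed.

(** The symmetric inequality is applied to the dilation of (Y - M) / c, of norm at most 1 because 2
    b <= c. The scale [c] stays free: enlarging it weakens the linear term of the exponent but
    weakens the quadratic one faster. *)
Lemma matrix_bernstein_rect (R : realType) (T : finType) m n (Y : T -> 'M[R]_(m, n))
    (M : 'M[R]_(m, n)) (b w c d : R) q :
  (0 < #|T|)%N -> (0 < q)%N -> (forall t, opb b (Y t)) ->
  M = #|T|%:R^-1 *: \sum_t Y t ->
  0 <= b -> 0 <= w -> 0 < d -> 0 < c -> 2 * b <= c ->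
  (forall x : 'cV[R]_n, avg (fun t => dot (Y t *m x) (Y t *m x)) <= w * dot x x) ->
  (forall x : 'cV[R]_m,
    avg (fun t => dot ((Y t)^T *m x) ((Y t)^T *m x)) <= w * dot x x) ->
  1 - 2 * (m + n)%:R * expR (4 * (w / c ^+ 2) * q%:R - (q%:R * d / c) / 2) <=
  Pseq R q (fun s => opb d (q%:R^-1 *: (\sum_(t <- s) Y t) - M)).
Proof.
move=> T0 q0 hY hM b0 w0 d0 c0 bc hw hwT.
have q0' : (0 : R) < q%:R by rewrite ltr0n.
have T0' : (0 : R) < #|T|%:R by rewrite ltr0n.
have MT : #|T|%:R *: M = \sum_t Y t by rewrite hM scalerA mulfV ?scale1r ?gt_eqF.
have opbM' : opb b M.
  have := opb_sum (index_enum T) (fun _ => b0) hY.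
  rewrite -MT => /(opbZ #|T|%:R^-1).
  rewrite scalerA mulVf ?gt_eqF // scale1r sumr_const -[b *+ _]mulr_natl mulrA.
  by rewrite mulVf ?gt_eqF // mul1r.
pose B t := c^-1 *: dilation (Y t - M).
(* Centring only lowers second moments: the mean of |(Z - N) x|^2 is the mean of |Z x|^2 minus |N
   x|^2. *)
have avg_quad p p' (Z : T -> 'M[R]_(p, p')) (N : 'M[R]_(p, p')) (x : 'cV[R]_p') :
    #|T|%:R *: N = \sum_t Z t ->
    avg (fun t => dot ((Z t - N) *m x) ((Z t - N) *m x)) <=
    avg (fun t => dot (Z t *m x) (Z t *m x)).
  move=> hN.
  rewrite (@eq_avg _ _ _ (fun t => dot (Z t *m x) (Z t *m x) +
    ((- 2) * dot (Z t *m x) (N *m x) + dot (N *m x) (N *m x)))); last first.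
    move=> t; rewrite mulmxBl dotBl !dotBr (dotC (N *m x)); ring.
  rewrite !avgD avgZ avg_cst //.
  have -> : avg (fun t => dot (Z t *m x) (N *m x)) = dot (N *m x) (N *m x).
    rewrite /avg -dot_suml -mulmx_suml -hN -scalemxAl dotZl mulrA mulVf ?mul1r //.
    by rewrite gt_eqF.
  have := dot_ge0 (N *m x); lra.
have := @matrix_bernstein R T (m + n) B (w / c ^+ 2) (q%:R * d / c) q T0.
move=> h; apply: le_trans (h _ _ _ _ _ _) _.
- by move=> t; rewrite /B -dilationZ; exact: dilation_sym.
- move=> t; apply: (@opbW _ _ _ (c^-1 * (b + b))).
  + by rewrite mulr_ge0 ?invr_ge0 ?addr_ge0 // ltW.
  + by rewrite ler_pdivrMl // mulr1; lra.
  + by apply: opbZ; apply: opb_dilation; apply: opbD => //; exact: opbN.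
- rewrite -scaler_sumr -dilation_sum sumrB -MT sumr_const -scaler_nat subrr.
  by rewrite dilation0 scaler0.
- by rewrite divr_ge0 ?sqr_ge0.
- by rewrite divr_ge0 ?mulr_ge0 ?ltW.
- move=> x; rewrite -(vsubmxK x); set y := usubmx x; set z := dsubmx x.
  rewrite (@eq_avg _ _ _ (fun t => (c ^+ 2)^-1 *
     (dot ((Y t - M) *m z) ((Y t - M) *m z) +
      dot (((Y t)^T - M^T) *m y) (((Y t)^T - M^T) *m y)))); last first.
    move=> t; rewrite /B -scalemxAl dotZl dotZr mul_dilation dot_col_mx.
    by rewrite linearB /= mulrA -expr2 exprVn.
  rewrite avgZ avgD dot_col_mx mulrAC mulrC ler_wpM2r ?invr_ge0 ?sqr_ge0 //.
  rewrite mulrDr addrC; apply: lerD.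
    apply: le_trans (avg_quad _ _ _ _ _ _) (hwT y).
    by rewrite -linear_sum -MT linearZ.
  by apply: le_trans (avg_quad _ _ _ _ _ _) (hw z).
apply: Pseq_le => s hs hx; apply: dilation_opb => // x.
have e : \sum_(t <- s) B t = (q%:R / c) *: dilation (q%:R^-1 *: (\sum_(t <- s) Y t) - M).
  rewrite -dilationZ scalerBr scalerA mulrAC mulfV ?gt_eqF // mul1r.
  rewrite /B -scaler_sumr -dilation_sum -dilationZ; congr dilation.
  rewrite sumrB scalerBr; congr (_ - _).
  by rewrite big_const_seq count_predT hs iter_addr_0 -scaler_nat scalerA mulrC.
have := hx x; rewrite e -scalemxAl dotZr => h1.
have qc : 0 < q%:R / c by rewrite divr_gt0.
by rewrite -(ler_pM2l qc); apply: le_trans h1 _; rewrite le_eqVlt; apply/orP; left; apply/eqP; ring.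
Qed.

(* The scale [c = 128 * k * be * a] in [matrix_bernstein_rect] makes the linear
   term of the exponent twice the quadratic one. *)
Lemma batch_concentration (R : realType) (T : finType) m n (Y : T -> 'M[R]_(m, n))
    (M : 'M[R]_(m, n)) (be a k l : R) q :
  (0 < #|T|)%N -> (0 < q)%N -> 0 < be -> 0 < a -> 1 <= k ->
  2 ^+ 17 * k ^+ 2 * be * l <= q%:R ->
  (forall t, opb (be * a) (Y t)) ->
  M = #|T|%:R^-1 *: \sum_t Y t ->
  (forall x : 'cV[R]_n,
    avg (fun t => dot (Y t *m x) (Y t *m x)) <= be * a ^+ 2 * dot x x) ->
  (forall x : 'cV[R]_m,
    avg (fun t => dot ((Y t)^T *m x) ((Y t)^T *m x)) <= be * a ^+ 2 * dot x x) ->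
  1 - 2 * (m + n)%:R * expR (- (32 * l)) <=
  Pseq R q (fun s => opb (a / (8 * k)) (q%:R^-1 *: (\sum_(t <- s) Y t) - M)).
Proof.
move=> T0 q0 be0 a0 k1 hq hY hM hw hwT.
have k0 : 0 < k by exact: lt_le_trans k1.
pose c := 128 * k * be * a.
have c0 : 0 < c by rewrite !mulr_gt0.
have ba0 : 0 < be * a by rewrite mulr_gt0.
have cb : 2 * (be * a) <= c.
  by rewrite /c -!mulrA [k * _]mulrC; nra.
apply: le_trans (matrix_bernstein_rect T0 q0 hY hM (ltW ba0) _ _ c0 cb hw hwT).
- rewrite lerD2l lerN2 ler_wpM2l ?mulr_ge0 // ler_expR.
  (* The quadratic term is q / (2^12 k^2 be), the linear one q / (2^11 k^2 be). With 2^17 = 32 *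
     2^12 in the hypothesis on [q], their difference is at least 32 l. *)
  have -> : 4 * (be * a ^+ 2 / c ^+ 2) * q%:R - q%:R * (a / (8 * k)) / c / 2 =
            - (q%:R / (2 ^+ 12 * k ^+ 2 * be)).
    by rewrite /c; field; rewrite !gt_eqF.
  rewrite lerN2 ler_pdivlMr ?mulr_gt0 ?exprn_gt0 //; apply: le_trans hq.
  by rewrite le_eqVlt; apply/orP; left; apply/eqP; ring.
- by rewrite mulr_ge0 ?sqr_ge0 // ltW.
- by rewrite divr_gt0 ?mulr_gt0.
Qed.

(** * Sampling operators *)

(** Sampling is with replacement: a repeated entry counts with its multiplicity, and the weight n1
    n2 / q makes [Z] the mean over lists of [q] uniform samples. *)
Definition samp (R : realType) (n1 n2 q : nat) (s : seq ('I_n1 * 'I_n2))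
    (Z : 'M[R]_(n1, n2)) : 'M[R]_(n1, n2) :=
  q%:R^-1 *: \sum_(t <- s) ((n1 * n2)%:R * Z t.1 t.2) *: delta_mx t.1 t.2.

Lemma mul_delta_mx_col (R : realFieldType) m n p (L : 'M[R]_(m, n)) (y : 'cV[R]_p) i j :
  L *m (delta_mx i j *m y) = y j 0 *: col i L.
Proof.
have -> : delta_mx i j *m y = y j 0 *: delta_mx i 0.
  apply/matrixP => a b; rewrite ord1 !mxE (bigD1 j) //= big1 => [|k kj].
    by rewrite !mxE !eqxx !andbT addr0 mulrC.
  by rewrite mxE (negbTE kj) andbF mul0r.
by rewrite -scalemxAr -colE.
Qed.

Lemma coord_sqr_le (R : realFieldType) m n (M : 'M[R]_(m, n)) (x : 'cV[R]_n) i :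
  ((M *m x) i 0) ^+ 2 <= dot (row i M) (row i M) * dot x x.
Proof.
have -> : (M *m x) i 0 = dot (row i M)^T x.
  by rewrite /dot trmxK -row_mul /mxtrace big_ord1 [RHS]mxE.
by rewrite -(dot_trmx (row i M)); exact: cauchy_schwarz.
Qed.

Lemma dot_cV (R : realFieldType) m (x : 'cV[R]_m) : dot x x = \sum_i x i 0 ^+ 2.
Proof. by rewrite dotE; apply: eq_bigr => i _; rewrite big_ord1. Qed.

Lemma avg_pair (R : realType) n1 n2 (F : 'I_n1 -> 'I_n2 -> R) :
  avg (fun t : 'I_n1 * 'I_n2 => F t.1 t.2) = (n1 * n2)%:R^-1 * \sum_i \sum_j F i j.
Proof.
by rewrite /avg card_prod !card_ord pair_bigA.
Qed.

(** [L] and [W] are test matrices: identities measure the operator norm of the deviation, a row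
    selector together with [V] measures the part of a row that [PT] sees. Each sample contributes a
    matrix of rank at most one, so the three hypotheses on [Z] are its uniform bound and the two
    variances. *)
Lemma samp_concentration (R : realType) n1 n2 d1 d2 (Z : 'M[R]_(n1, n2))
    (L : 'M[R]_(d1, n1)) (W : 'M[R]_(n2, d2)) (be a k l : R) q
    (N := (n1 * n2)%:R : R) :
  (0 < n1 * n2)%N -> (0 < q)%N -> 0 < be -> 0 < a -> 1 <= k ->
  2 ^+ 17 * k ^+ 2 * be * l <= q%:R ->
  opb 1 L -> opb 1 W ->
  (forall i j, N ^+ 2 * (Z i j ^+ 2 * dot (col i L) (col i L) * dot (row j W) (row j W))
     <= (be * a) ^+ 2) ->
  (forall j, N * \sum_i Z i j ^+ 2 * dot (col i L) (col i L) <= be * a ^+ 2) ->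
  (forall i, N * \sum_j Z i j ^+ 2 * dot (row j W) (row j W) <= be * a ^+ 2) ->
  1 - 2 * (d1 + d2)%:R * expR (- (32 * l)) <=
  Pseq R q (fun s => opb (a / (8 * k)) (L *m (samp q s Z - Z) *m W)).
Proof.
move=> N0 q0 be0 a0 k1 hq hL hW h1 h2 h3.
have N0' : 0 < N by rewrite ltr0n.
pose Y (t : 'I_n1 * 'I_n2) := L *m ((N * Z t.1 t.2) *: delta_mx t.1 t.2) *m W.
have Yx t (x : 'cV[R]_d2) : dot (Y t *m x) (Y t *m x) =
    N ^+ 2 * (Z t.1 t.2 ^+ 2 * dot (col t.1 L) (col t.1 L) * (W *m x) t.2 0 ^+ 2).
  rewrite /Y -!mulmxA -scalemxAl -scalemxAr mul_delta_mx_col !dotZl !dotZr; ring.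
have YTx t (x : 'cV[R]_d1) : dot ((Y t)^T *m x) ((Y t)^T *m x) =
    N ^+ 2 * (Z t.1 t.2 ^+ 2 * dot (row t.2 W) (row t.2 W) * (L^T *m x) t.1 0 ^+ 2).
  rewrite /Y !trmx_mul linearZ /= trmx_delta -!mulmxA -scalemxAl -scalemxAr.
  by rewrite mul_delta_mx_col !dotZl !dotZr -tr_row dot_trmx; ring.
have T0 : (0 < #|{: 'I_n1 * 'I_n2}|)%N by rewrite card_prod !card_ord.
apply: le_trans (@batch_concentration R _ d1 d2 Y (L *m Z *m W) be a k l q T0 q0 be0 a0 k1 hq _ _ _ _) _.
- move=> t x; rewrite Yx; apply: le_trans (_ : _ <= N ^+ 2 * (Z t.1 t.2 ^+ 2 *
    dot (col t.1 L) (col t.1 L) * (dot (row t.2 W) (row t.2 W) * dot x x))) _.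
    apply: ler_wpM2l; first exact: sqr_ge0.
    apply: ler_wpM2l; first by rewrite mulr_ge0 ?sqr_ge0 ?dot_ge0.
    exact: coord_sqr_le.
  rewrite [_ * (_ * dot x x)]mulrA mulrA; apply: ler_wpM2r => //; exact: dot_ge0.
- rewrite card_prod !card_ord -/N /Y -mulmx_suml -mulmx_sumr.
  have -> : \sum_(t : 'I_n1 * 'I_n2) (N * Z t.1 t.2) *: delta_mx t.1 t.2 = N *: Z.
    rewrite [Z in RHS]matrix_sum_delta pair_bigA scaler_sumr /=.
    by apply: eq_bigr => t _; rewrite scalerA.
  by rewrite -scalemxAr -scalemxAl scalerA mulVf ?scale1r // gt_eqF.
- move=> x; rewrite (eq_avg (fun t => Yx t x)).
  rewrite (avg_pair (fun i j => N ^+ 2 * (Z i j ^+ 2 * dot (col i L) (col i L) *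
    (W *m x) j 0 ^+ 2))) exchange_big mulr_sumr.
  apply: le_trans (_ : be * a ^+ 2 * dot (W *m x) (W *m x) <= _); last first.
    apply: ler_wpM2l; first by rewrite mulr_ge0 ?sqr_ge0 // ltW.
    by have := hW x; rewrite expr1n mul1r.
  rewrite dot_cV mulr_sumr; apply: ler_sum => j _.
  apply: le_trans (_ : (N * \sum_i Z i j ^+ 2 * dot (col i L) (col i L)) *
    (W *m x) j 0 ^+ 2 <= _); last by rewrite ler_wpM2r ?sqr_ge0.
  rewrite -mulr_sumr -mulr_suml -/N le_eqVlt; apply/orP; left; apply/eqP.
  by rewrite expr2 -!mulrA mulKf ?gt_eqF.
- move=> x; rewrite (eq_avg (fun t => YTx t x)).
  rewrite (avg_pair (fun i j => N ^+ 2 * (Z i j ^+ 2 * dot (row j W) (row j W) *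
    (L^T *m x) i 0 ^+ 2))) mulr_sumr.
  apply: le_trans (_ : be * a ^+ 2 * dot (L^T *m x) (L^T *m x) <= _); last first.
    apply: ler_wpM2l; first by rewrite mulr_ge0 ?sqr_ge0 // ltW.
    by have := opb_trmx hL x; rewrite expr1n mul1r.
  rewrite dot_cV mulr_sumr; apply: ler_sum => i _.
  apply: le_trans (_ : (N * \sum_j Z i j ^+ 2 * dot (row j W) (row j W)) *
    (L^T *m x) i 0 ^+ 2 <= _); last by rewrite ler_wpM2r ?sqr_ge0.
  rewrite -mulr_sumr -mulr_suml -/N le_eqVlt; apply/orP; left; apply/eqP.
  by rewrite expr2 -!mulrA mulKf ?gt_eqF.
apply: Pseq_le => s _; rewrite /samp mulmxBr mulmxBl -scalemxAr -scalemxAl.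
by rewrite mulmx_sumr mulmx_suml.
Qed.

(** * Golfing *)

(* The orthogonal projector onto the tangent space T = {U A + B V^T}. *)
Definition PT (R : realFieldType) n1 n2 r (U : 'M[R]_(n1, r)) (V : 'M[R]_(n2, r))
    (Z : 'M[R]_(n1, n2)) : 'M[R]_(n1, n2) :=
  U *m U^T *m Z + Z *m (V *m V^T) - U *m U^T *m Z *m (V *m V^T).


Lemma PTE (R : realFieldType) n1 n2 r (U : 'M[R]_(n1, r)) (V : 'M[R]_(n2, r)) Z :
  PT U V Z = Z - (1%:M - U *m U^T) *m Z *m (1%:M - V *m V^T).
Proof.
rewrite mulmxBl mul1mx mulmxBr mulmx1 mulmxBl !opprB /PT.
by rewrite addrA addrC !addrA subrK addrAC.
Qed.

Lemma PT_linear (R : realFieldType) n1 n2 r (U : 'M[R]_(n1, r)) (V : 'M[R]_(n2, r)) :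
  linear (PT U V).
Proof.
move=> a X Y; rewrite !PTE.
set P := 1%:M - U *m U^T; set Q := 1%:M - V *m V^T; rewrite (mulmxDr P) mulmxDl -scalemxAr -scalemxAl.
by rewrite scalerBr opprD addrACA.
Qed.

HB.instance Definition _ (R : realFieldType) n1 n2 r (U : 'M[R]_(n1, r))
    (V : 'M[R]_(n2, r)) :=
  GRing.isLinear.Build R 'M[R]_(n1, n2) 'M[R]_(n1, n2) *:%R (PT U V) (PT_linear U V).

Lemma proj_compl_idem (R : realFieldType) n r (U : 'M[R]_(n, r)) :
  U^T *m U = 1%:M ->
  (1%:M - U *m U^T) *m (1%:M - U *m U^T) = 1%:M - U *m U^T.
Proof.
move=> hU; rewrite mulmxBr mulmx1 mulmxBl mul1mx.
by rewrite mulmxA -(mulmxA U) hU mulmx1 subrr subr0.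
Qed.

Lemma proj_compl_tr (R : realFieldType) n r (U : 'M[R]_(n, r)) :
  (1%:M - U *m U^T)^T = 1%:M - U *m U^T.
Proof. by rewrite linearB /= trmx1 trmx_mul trmxK. Qed.

Lemma PT_idem (R : realFieldType) n1 n2 r (U : 'M[R]_(n1, r)) (V : 'M[R]_(n2, r)) Z :
  U^T *m U = 1%:M -> V^T *m V = 1%:M -> PT U V (PT U V Z) = PT U V Z.
Proof.
move=> hU hV; rewrite [LHS]PTE [X in _ - X](_ : _ = 0) ?subr0 //.
have hP := proj_compl_idem hU; have hQ := proj_compl_idem hV; rewrite PTE.
set P := _ - U *m _ in hP *; set Q := _ - V *m _ in hQ *.
by rewrite (mulmxBr P) mulmxBl !mulmxA hP -[X in _ - X]mulmxA hQ subrr.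
Qed.

Lemma dot_PT (R : realFieldType) n1 n2 r (U : 'M[R]_(n1, r)) (V : 'M[R]_(n2, r)) X Y :
  dot X (PT U V Y) = dot (PT U V X) Y.
Proof.
rewrite !PTE dotBr dotBl; congr (_ - _).
by rewrite dot_mulr dot_mull !proj_compl_tr mulmxA.
Qed.

Lemma PT_tr (R : realFieldType) n1 n2 r (U : 'M[R]_(n1, r)) (V : 'M[R]_(n2, r)) Z :
  (PT U V Z)^T = PT V U Z^T.
Proof.
by rewrite !PTE linearB /= !trmx_mul !proj_compl_tr !mulmxA.
Qed.

Lemma opb_isom (R : realFieldType) n r (U : 'M[R]_(n, r)) :
  U^T *m U = 1%:M -> opb 1 U.
Proof. by move=> hU x; rewrite dot_mull mulmxA hU mul1mx expr1n mul1r. Qed.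

Lemma opb_proj_compl (R : realFieldType) n r (U : 'M[R]_(n, r)) :
  U^T *m U = 1%:M -> opb 1 (1%:M - U *m U^T).
Proof.
move=> hU x; rewrite dot_mull proj_compl_tr mulmxA proj_compl_idem //.
rewrite mulmxBl mul1mx dotBl expr1n mul1r gerBl.
by rewrite dotC -mulmxA dot_mull; exact: dot_ge0.
Qed.

Lemma opb_PTc (R : realFieldType) n1 n2 r (U : 'M[R]_(n1, r)) (V : 'M[R]_(n2, r)) Z t :
  U^T *m U = 1%:M -> V^T *m V = 1%:M -> opb t Z -> opb t (Z - PT U V Z).
Proof.
move=> hU hV h; rewrite PTE opprB addrC subrK -[t]mul1r -[1 * t]mulr1.
by apply: opbM; [apply: opbM => //|]; exact: opb_proj_compl.
Qed.

Lemma dot_PT_le (R : realFieldType) n1 n2 r (U : 'M[R]_(n1, r)) (V : 'M[R]_(n2, r)) Z :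
  U^T *m U = 1%:M -> V^T *m V = 1%:M -> dot (PT U V Z) (PT U V Z) <= dot Z Z.
Proof.
move=> hU hV.
have e : dot (PT U V Z) Z = dot (PT U V Z) (PT U V Z) by rewrite [RHS]dot_PT PT_idem.
move: (PT U V Z) e => W e; have := dot_ge0 (Z - W).
rewrite dotBl !dotBr (dotC Z W) e; lra.
Qed.

Lemma dot_row (R : realFieldType) m n (M : 'M[R]_(m, n)) i :
  dot (row i M) (row i M) = \sum_j M i j ^+ 2.
Proof. by rewrite dotE big_ord1; apply: eq_bigr => j _; rewrite !mxE. Qed.

Lemma row_trmx_col (R : realFieldType) m n (M : 'M[R]_(m, n)) i :
  dot (row i M^T) (row i M^T) = dot (col i M) (col i M).
Proof. by rewrite -tr_col dot_trmx. Qed.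

(** Incoherence at scale [A], as enjoyed by U diag(s) V^T when the entries of s lie in [0, A] and
    p1, p2 bound the squared row norms of U, V. Row and column sums are carried along because the
    variances need them: with p1 = mu r / n1, adding up the entry bounds over a column would lose a
    factor n1 p1 = mu r. *)
Record bounded_by (R : realFieldType) n1 n2 (p1 p2 A : R) (Z : 'M[R]_(n1, n2)) : Prop :=
  BoundedBy {
    bounded_entry : forall i j, Z i j ^+ 2 <= p1 * p2 * A ^+ 2;
    bounded_row : forall i, \sum_j Z i j ^+ 2 <= p1 * A ^+ 2;
    bounded_col : forall j, \sum_i Z i j ^+ 2 <= p2 * A ^+ 2 }.

Lemma PT_row_bound (R : realType) n1 n2 r (U : 'M[R]_(n1, r)) (V : 'M[R]_(n2, r))
    (D : 'M[R]_(n1, n2)) (p1 d : R) i :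
  U^T *m U = 1%:M -> V^T *m V = 1%:M -> 0 <= p1 -> 0 <= d ->
  dot (row i U) (row i U) <= p1 -> opb d D ->
  dot (row i D *m V) (row i D *m V) <= p1 * d ^+ 2 ->
  dot (row i (PT U V D)) (row i (PT U V D)) <= p1 * (4 * d) ^+ 2.
Proof.
move=> hU hV p0 d0 hp hD hr; set s := Num.sqrt p1.
have ss : s ^+ 2 = p1 by rewrite sqr_sqrtr.
have s0 : 0 <= s by exact: sqrtr_ge0.
have -> : row i (PT U V D) =
    row i U *m U^T *m D *m (1%:M - V *m V^T) + row i D *m V *m V^T.
  by rewrite mulmxBr mulmx1 /PT linearB linearD /= !row_mul -!mulmxA addrAC.
have h1 : dot (row i U *m U^T *m D) (row i U *m U^T *m D) <= (s * d) ^+ 2.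
  rewrite -dot_trmx trmx_mul; apply: le_trans (opb_trmx hD _) _.
  rewrite exprMn mulrC ss ler_wpM2r ?sqr_ge0 // dot_trmx dot_mulr trmxK -mulmxA hU mulmx1.
  exact: hp.
apply: le_trans (minkowski (mulr_ge0 s0 d0) (mulr_ge0 s0 d0) _ _) _.
- rewrite -dot_trmx trmx_mul; apply: le_trans (opb_mx _ (opb_trmx (opb_proj_compl hV))) _.
  by rewrite expr1n mul1r dot_trmx.
- by rewrite dot_mulr trmxK -[_ *m V *m V^T *m V]mulmxA hV mulmx1 exprMn ss.
rewrite -mulrDr exprMn exprMn -ss -mulrA; nra.
Qed.

(** No norm of a full row or column of [D] is required. A row of the projection involves a row of D
    V and a row of U U^T D, and the latter is at most sqrt p1 times the operator norm; columns are
    symmetric. This costs 2 d for rows and columns and 3 d for entries, and 4 d covers both. *)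
Lemma PT_bounded (R : realType) n1 n2 r (U : 'M[R]_(n1, r)) (V : 'M[R]_(n2, r))
    (D : 'M[R]_(n1, n2)) (p1 p2 d : R) :
  U^T *m U = 1%:M -> V^T *m V = 1%:M -> 0 <= p1 -> 0 <= p2 -> 0 <= d ->
  (forall i, dot (row i U) (row i U) <= p1) ->
  (forall j, dot (row j V) (row j V) <= p2) ->
  opb d D ->
  (forall i, dot (row i D *m V) (row i D *m V) <= p1 * d ^+ 2) ->
  (forall j, dot (U^T *m col j D) (U^T *m col j D) <= p2 * d ^+ 2) ->
  bounded_by p1 p2 (4 * d) (PT U V D).
Proof.
move=> hU hV p10 p20 d0 hu hv hD hr hc.
have hc' j : dot (row j D^T *m U) (row j D^T *m U) <= p2 * d ^+ 2.
  by rewrite -tr_col -[U]trmxK -trmx_mul dot_trmx.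
split=> [i j|i|j]; last first.
- have := PT_row_bound hV hU p20 d0 (hv j) (opb_trmx hD) (hc' j).
  by rewrite -PT_tr dot_row; under eq_bigr do rewrite mxE.
- by have := PT_row_bound hU hV p10 d0 (hu i) hD (hr i); rewrite dot_row.
set s1 := Num.sqrt p1; set s2 := Num.sqrt p2.
have ss1 : s1 ^+ 2 = p1 by rewrite sqr_sqrtr.
have ss2 : s2 ^+ 2 = p2 by rewrite sqr_sqrtr.
have s10 : 0 <= s1 by exact: sqrtr_ge0.
have s20 : 0 <= s2 by exact: sqrtr_ge0.
pose x1 := (row i U)^T; pose y1 := U^T *m col j D.
pose x2 := (row j V)^T; pose y2 := (row i D *m V)^T.
have e : PT U V D i j = dot x1 y1 + (dot y2 x2 - dot (U *m x1) (D *m (V *m x2))).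
  have f n (A : 'M[R]_(n1, n)) (B : 'M[R]_(n, n2)) :
      (A *m B) i j = \tr (row i A *m col j B).
    by rewrite /mxtrace big_ord1 !mxE; apply: eq_bigr => k _; rewrite !mxE.
  rewrite /PT 2!mxE [X in _ + X]mxE -(mulmxA U) !(mulmxA _ V) !f.
  rewrite /dot /x1 /x2 /y1 /y2 !trmx_mul !trmxK tr_row !row_mul !colE !mulmxA.
  by rewrite addrA.
have sq (a b : R) : `|a| <= b -> a ^+ 2 <= b ^+ 2.
  move=> h; rewrite -real_normK ?num_real //; apply: lerXn2r; rewrite ?nnegrE //.
  by apply: le_trans h.
have nd m n' (X Y : 'M[R]_(m, n')) a b : 0 <= a -> 0 <= b ->
    dot X X <= a ^+ 2 -> dot Y Y <= b ^+ 2 -> `|dot X Y| <= a * b.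
  move=> a0 b0 ha hb; rewrite ler_norml; apply/andP; split; last exact: dot_scale_le.
  by rewrite lerNl -dotNl; apply: dot_scale_le; rewrite ?dotNl ?dotNr ?opprK.
have hx1 : dot x1 x1 <= s1 ^+ 2 by rewrite ss1 dot_trmx.
have hx2 : dot x2 x2 <= s2 ^+ 2 by rewrite ss2 dot_trmx.
have b1 : `|dot x1 y1| <= s1 * (s2 * d).
  by apply: nd; rewrite ?mulr_ge0 // exprMn ss2; exact: hc.
have b2 : `|dot y2 x2| <= (s1 * d) * s2.
  by apply: nd; rewrite ?mulr_ge0 // exprMn ss1 dot_trmx; exact: hr.
have b3 : `|dot (U *m x1) (D *m (V *m x2))| <= s1 * (d * s2).
  apply: nd; rewrite ?mulr_ge0 //.
    by apply: le_trans (opb_isom hU _) _; rewrite expr1n mul1r.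
  apply: le_trans (hD _) _; rewrite exprMn ler_wpM2l ?sqr_ge0 //.
  by apply: le_trans (opb_isom hV _) _; rewrite expr1n mul1r.
rewrite e -ss1 -ss2 -!exprMn; apply: sq.
apply: le_trans (ler_normD _ _) _; have := ler_normB (dot y2 x2) (dot (U *m x1) (D *m (V *m x2))).
have : 0 <= s1 * s2 * d by rewrite !mulr_ge0.
lra.
Qed.

Lemma dot_delta_row (R : realFieldType) n (k i : 'I_n) :
  dot (col i (delta_mx 0 k : 'rV[R]_n)) (col i (delta_mx 0 k : 'rV[R]_n)) = (i == k)%:R.
Proof. by rewrite dot_cV big_ord1 !mxE eqxx /= expr2 -natrM mulnb andbb. Qed.

Lemma opb_delta_row (R : realFieldType) n (k : 'I_n) :
  opb 1 (delta_mx 0 k : 'rV[R]_n).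
Proof.
apply: opb_frob; rewrite dot_col; under eq_bigr do rewrite dot_delta_row.
by rewrite (bigD1 k) //= eqxx big1 ?addr0 ?expr1n // => i /negbTE ->.
Qed.

Lemma opb_cV (R : realFieldType) n t (M : 'cV[R]_n) : opb t M -> dot M M <= t ^+ 2.
Proof.
move=> /(_ 1%:M); rewrite mulmx1 => /le_trans; apply.
by rewrite /dot trmx1 mulmx1 mxtrace1 mulr1.
Qed.

Lemma opb_rV (R : realFieldType) n t (M : 'rV[R]_n) : opb t M -> dot M M <= t ^+ 2.
Proof. by move=> /opb_trmx /opb_cV; rewrite dot_trmx. Qed.

Lemma sum_delta (R : realFieldType) n (k : 'I_n) (F : 'I_n -> R) :
  \sum_i F i * (i == k)%:R = F k.
Proof.
by rewrite (bigD1 k) //= eqxx mulr1 big1 ?addr0 // => i /negbTE ->; rewrite mulr0.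
Qed.

(** With the selector of row [i0] on the left and [V] on the right the deviation is a single row of
    length [r], so its operator norm is its Euclidean norm. The scale is sqrt p1 A, the row scale of
    [bounded_by]. *)
Lemma samp_row_concentration (R : realType) n1 n2 r (V : 'M[R]_(n2, r))
    (Z : 'M[R]_(n1, n2)) (p1 p2 A be k l : R) q (i0 : 'I_n1) (N := (n1 * n2)%:R : R) :
  (0 < n1 * n2)%N -> (0 < q)%N -> 0 < be -> 0 < A -> 1 <= k ->
  2 ^+ 17 * k ^+ 2 * be * l <= q%:R ->
  0 < p1 -> 0 < p2 -> N * p2 <= be -> V^T *m V = 1%:M ->
  (forall j, dot (row j V) (row j V) <= p2) -> bounded_by p1 p2 A Z ->
  1 - 2 * (1 + r)%:R * expR (- (32 * l)) <=
  Pseq R q (fun s => dot (row i0 (samp q s Z - Z) *m V) (row i0 (samp q s Z - Z) *m V)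
    <= p1 * (A / (8 * k)) ^+ 2).
Proof.
move=> N0 q0 be0 A0 k1 hq p10 p20 hp hV hv [he hr hc].
have N0' : 0 < N by rewrite ltr0n.
pose a := Num.sqrt p1 * A.
have sp : Num.sqrt p1 ^+ 2 = p1 by rewrite sqr_sqrtr // ltW.
have a0 : 0 < a by rewrite mulr_gt0 // sqrtr_gt0.
have a2 : a ^+ 2 = p1 * A ^+ 2 by rewrite exprMn sp.
have P0 : 0 <= p1 * A ^+ 2 by rewrite mulr_ge0 ?sqr_ge0 // ltW.
have g : N * (p1 * p2 * A ^+ 2) <= be * a ^+ 2.
  by rewrite a2 (_ : _ * (_ * _) = N * p2 * (p1 * A ^+ 2)) ?ler_wpM2r //; ring.
apply: le_trans (samp_concentration (L := delta_mx 0 i0 : 'rV[R]_n1) (W := V) (Z := Z)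
  N0 q0 be0 a0 k1 hq (@opb_delta_row _ _ _) (opb_isom hV) _ _ _) _ => //.
- move=> i j; rewrite dot_delta_row; case: (i == i0); last first.
    by rewrite mulr0 mul0r mulr0 sqr_ge0.
  rewrite mulr1 -/N exprMn a2.
  apply: le_trans (_ : N ^+ 2 * (p1 * p2 * A ^+ 2 * p2) <= _).
    rewrite ler_wpM2l ?sqr_ge0 //; apply: ler_pM; rewrite ?sqr_ge0 ?dot_ge0 //.
  rewrite (_ : _ * (_ * p2) = (N * p2) ^+ 2 * (p1 * A ^+ 2)); last by ring.
  rewrite ler_wpM2r //; apply: lerXn2r; rewrite ?nnegrE ?(ltW be0) //.
  by rewrite mulr_ge0 ?ltW.
- move=> j; under eq_bigr do rewrite dot_delta_row.
  rewrite (sum_delta i0 (fun i => Z i j ^+ 2)) -/N; apply: le_trans g.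
  by apply: ler_wpM2l; [exact: ltW|exact: he].
- move=> i; rewrite -/N; apply: le_trans (_ : N * (p1 * A ^+ 2 * p2) <= _); last first.
    by apply: le_trans g; rewrite le_eqVlt; apply/orP; left; apply/eqP; ring.
  rewrite ler_wpM2l ?(ltW N0') //; apply: le_trans (_ : (\sum_j Z i j ^+ 2) * p2 <= _).
    by rewrite mulr_suml; apply: ler_sum => j _; rewrite ler_wpM2l ?sqr_ge0.
  by rewrite ler_wpM2r ?(ltW p20).
apply: Pseq_le => s _ h.
rewrite rowE; apply: le_trans (opb_rV h) _.
by rewrite !expr_div_n a2 [leRHS]mulrA.
Qed.

(** * Columns from rows, by transposition of the samples *)

Lemma Eseq_bij (R : realType) (T T' : finType) (h : T -> T') q (f : seq T' -> R) :
  bijective h -> Eseq q (fun s => f (map h s)) = Eseq q f.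
Proof.
move=> hb; elim: q f => [//|q IH] f /=.
rewrite /avg (bij_eq_card hb) [in RHS](reindex h) /=; last exact: onW_bij.
by congr (_ * _); apply: eq_bigr => t _; rewrite -IH.
Qed.

Lemma Pseq_bij (R : realType) (T T' : finType) (h : T -> T') q (P : seq T' -> Prop) :
  bijective h -> Pseq R q (fun s => P (map h s)) = Pseq R q P.
Proof. exact: (@Eseq_bij R T T' h q (fun s => (`[< P s >] : nat)%:R)). Qed.

Definition swap (S T : Type) (t : S * T) : T * S := (t.2, t.1).

Lemma swap_bij (S T : Type) : bijective (@swap S T).
Proof. by exists (@swap T S); case. Qed.

Lemma samp_swap (R : realType) n1 n2 q s (Z : 'M[R]_(n1, n2)) :
  samp q (map (@swap _ _) s) Z^T = (samp q s Z)^T.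
Proof.
rewrite /samp big_map linearZ /= [X in _ = _ *: X]linear_sum; congr (_ *: _).
by apply: eq_bigr => t _; rewrite linearZ /= trmx_delta mxE mulnC.
Qed.

Lemma bounded_by_tr (R : realFieldType) n1 n2 (p1 p2 A : R) (Z : 'M[R]_(n1, n2)) :
  bounded_by p1 p2 A Z -> bounded_by p2 p1 A Z^T.
Proof.
move=> [he hr hc]; split=> [i j|i|j]; first by rewrite mxE (mulrC p2).
- by under eq_bigr do rewrite mxE.
- by under eq_bigr do rewrite mxE.
Qed.

Lemma samp_col_concentration (R : realType) n1 n2 r (U : 'M[R]_(n1, r))
    (Z : 'M[R]_(n1, n2)) (p1 p2 A be k l : R) q (j0 : 'I_n2) (N := (n1 * n2)%:R : R) :
  (0 < n1 * n2)%N -> (0 < q)%N -> 0 < be -> 0 < A -> 1 <= k ->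
  2 ^+ 17 * k ^+ 2 * be * l <= q%:R ->
  0 < p1 -> 0 < p2 -> N * p1 <= be -> U^T *m U = 1%:M ->
  (forall i, dot (row i U) (row i U) <= p1) -> bounded_by p1 p2 A Z ->
  1 - 2 * (1 + r)%:R * expR (- (32 * l)) <=
  Pseq R q (fun s => dot (U^T *m col j0 (samp q s Z - Z)) (U^T *m col j0 (samp q s Z - Z))
    <= p2 * (A / (8 * k)) ^+ 2).
Proof.
move=> N0 q0 be0 A0 k1 hq p10 p20 hp hU hu hZ.
rewrite /N mulnC in hp; rewrite mulnC in N0.
apply: le_trans (samp_row_concentration j0 N0 q0 be0 A0 k1 hq p20 p10 hp hU hu
  (bounded_by_tr hZ)) _.
rewrite -(Pseq_bij R q _ (swap_bij 'I_n1 'I_n2)).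
apply: Pseq_le => s _; rewrite samp_swap -linearB /= -tr_col -{1 2}[U]trmxK -trmx_mul.
by rewrite dot_trmx.
Qed.

(** The union bound of one golfing batch: 2 (n1 + n2) for the operator norm, plus 2 (1 + r) for each
    of the n1 rows and n2 columns. *)
Definition batch_err (R : realType) (n1 n2 r : nat) (l : R) : R :=
  (n1 + n2)%:R * (2 * (2 + r)%:R) * expR (- (32 * l)).

Lemma golf_step (R : realType) n1 n2 r (U : 'M[R]_(n1, r)) (V : 'M[R]_(n2, r))
    (Z : 'M[R]_(n1, n2)) (p1 p2 A be k l : R) q (N := (n1 * n2)%:R : R) :
  (0 < n1 * n2)%N -> (0 < q)%N -> 0 < be -> 0 < A -> 1 <= k ->
  2 ^+ 17 * k ^+ 2 * be * l <= q%:R ->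
  0 < p1 -> 0 < p2 -> N * p1 <= be -> N * p2 <= be ->
  U^T *m U = 1%:M -> V^T *m V = 1%:M ->
  (forall i, dot (row i U) (row i U) <= p1) ->
  (forall j, dot (row j V) (row j V) <= p2) -> bounded_by p1 p2 A Z ->
  1 - batch_err n1 n2 r l <=
  Pseq R q (fun s => opb (A / (8 * k)) (samp q s Z - Z) /\
    bounded_by p1 p2 (A / (2 * k)) (PT U V (samp q s Z - Z))).
Proof.
move=> N0 q0 be0 A0 k1 hq p10 p20 hp1 hp2 hU hV hu hv hZ.
have N0' : 0 < N by rewrite ltr0n.
have T0 : (0 < #|{: 'I_n1 * 'I_n2}|)%N by rewrite card_prod !card_ord.
have k0 : 0 < k by exact: lt_le_trans k1.
set e := expR (- (32 * l)); set d := A / (8 * k).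
have d0 : 0 <= d by rewrite divr_ge0 ?mulr_ge0 ?ltW.
have h1 : 1 - 2 * (n1 + n2)%:R * e <=
    Pseq R q (fun s => opb d (samp q s Z - Z)).
  have [he hr hc] := hZ.
  have c1 n (i : 'I_n) : dot (col i (1%:M : 'M[R]_n)) (col i 1%:M) = 1.
    by rewrite colE mul1mx /dot trmx_delta mul_delta_mx /mxtrace big_ord1 mxE.
  have r1 n (i : 'I_n) : dot (row i (1%:M : 'M[R]_n)) (row i 1%:M) = 1.
    by rewrite -[1%:M]trmx1 row_trmx_col c1.
  have A2 : 0 <= A ^+ 2 by exact: sqr_ge0.
  apply: le_trans (samp_concentration (L := 1%:M) (W := 1%:M) (Z := Z)
    N0 q0 be0 A0 k1 hq (@opb1 _ _) (@opb1 _ _) _ _ _) _.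
  - move=> i j; rewrite c1 r1 !mulr1 -/N exprMn.
    apply: le_trans (_ : N ^+ 2 * (p1 * p2 * A ^+ 2) <= _).
      by rewrite ler_wpM2l ?sqr_ge0.
    rewrite (_ : _ * (_ * _) = (N * p1) * (N * p2) * A ^+ 2); last by ring.
    rewrite ler_wpM2r // expr2; apply: ler_pM => //; apply: mulr_ge0; exact: ltW.
  - move=> j; under eq_bigr do rewrite c1 mulr1.
    apply: le_trans (_ : N * (p2 * A ^+ 2) <= _); last by rewrite mulrA ler_wpM2r.
    by apply: ler_wpM2l; [exact: ltW|exact: hc].
  - move=> j; under eq_bigr do rewrite r1 mulr1.
    apply: le_trans (_ : N * (p1 * A ^+ 2) <= _); last by rewrite mulrA ler_wpM2r.
    by apply: ler_wpM2l; [exact: ltW|exact: hr].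
  by apply: Pseq_le => s _; rewrite mul1mx mulmx1.
have h2 := Pseq_forall T0 (fun i => @samp_row_concentration R n1 n2 r V Z p1 p2 A be k l q i
  N0 q0 be0 A0 k1 hq p10 p20 hp2 hV hv hZ).
have h3 := Pseq_forall T0 (fun j => @samp_col_concentration R n1 n2 r U Z p1 p2 A be k l q j
  N0 q0 be0 A0 k1 hq p10 p20 hp1 hU hu hZ).
have := Pseq_and T0 h1 (Pseq_and T0 h2 h3); rewrite !card_ord.
have -> : 2 * (n1 + n2)%:R * e + (n1%:R * (2 * (1 + r)%:R * e) +
   n2%:R * (2 * (1 + r)%:R * e)) = batch_err n1 n2 r l.
  by rewrite /batch_err -/e; ring.
move=> /le_trans; apply; apply: Pseq_le => s _ [hD [hr hc]]; split=> //.
(* The 8 in the deviation was chosen for this: the factor 4 of [PT_bounded] still leaves a gain of 2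
   k. *)
have -> : A / (2 * k) = 4 * d by rewrite /d; field; rewrite gt_eqF.
by apply: PT_bounded; rewrite ?(ltW p10) ?(ltW p20).
Qed.

Definition supported (R : realFieldType) n1 n2 (s : seq ('I_n1 * 'I_n2))
    (M : 'M[R]_(n1, n2)) : Prop := forall i j, (i, j) \notin s -> M i j = 0.

Lemma supported_samp (R : realType) n1 n2 q s (Z : 'M[R]_(n1, n2)) :
  supported s (samp q s Z).
Proof.
move=> i j hs; rewrite /samp mxE summxE big_seq big1 ?mulr0 // => t ts.
rewrite !mxE; have [/andP [/eqP ei /eqP ej]|] := boolP ((i == t.1) && (j == t.2)).
  by move: ts hs; rewrite [t]surjective_pairing -ei -ej => ->.
by rewrite mulr0.
Qed.

Lemma supported_catl (R : realFieldType) n1 n2 s s' (M : 'M[R]_(n1, n2)) :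
  supported s M -> supported (s ++ s') M.
Proof. by move=> h i j; rewrite mem_cat negb_or => /andP [/h]. Qed.

Lemma supported_catr (R : realFieldType) n1 n2 s s' (M : 'M[R]_(n1, n2)) :
  supported s' M -> supported (s ++ s') M.
Proof. by move=> h i j; rewrite mem_cat negb_or => /andP [_ /h]. Qed.

Lemma supportedD (R : realFieldType) n1 n2 s (M M' : 'M[R]_(n1, n2)) :
  supported s M -> supported s M' -> supported s (M + M').
Proof. by move=> h h' i j hs; rewrite mxE h // h' // addr0. Qed.

Lemma bounded_byN (R : realFieldType) n1 n2 (p1 p2 A : R) (Z : 'M[R]_(n1, n2)) :
  bounded_by p1 p2 A Z -> bounded_by p1 p2 A (- Z).
Proof.
move=> [he hr hc]; split=> [i j|i|j]; first by rewrite mxE sqrrN.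
- by under eq_bigr do rewrite mxE sqrrN.
- by under eq_bigr do rewrite mxE sqrrN.
Qed.

(** The recursion peels off the first batch: Z - P_T (samp q s Z) lies in T and has scale A / (2k),
    so the remaining batches form an instance with a smaller target. Off T the first batch
    contributes A / (8k) and all later ones at most A / (8 k^2), together within A / (4k) as k >=
    1. *)
Lemma golfing (R : realType) n1 n2 r (U : 'M[R]_(n1, r)) (V : 'M[R]_(n2, r))
    (p1 p2 be k l : R) q (N := (n1 * n2)%:R : R) :
  (0 < n1 * n2)%N -> (0 < q)%N -> 0 < be -> 1 <= k ->
  2 ^+ 17 * k ^+ 2 * be * l <= q%:R ->
  0 < p1 -> 0 < p2 -> N * p1 <= be -> N * p2 <= be ->
  U^T *m U = 1%:M -> V^T *m V = 1%:M ->
  (forall i, dot (row i U) (row i U) <= p1) ->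
  (forall j, dot (row j V) (row j V) <= p2) ->
  forall (L : nat) (A : R) (Z : 'M[R]_(n1, n2)),
  0 < A -> PT U V Z = Z -> bounded_by p1 p2 A Z ->
  1 - L%:R * batch_err n1 n2 r l <=
  Pseq R (L * q) (fun s => exists M : 'M[R]_(n1, n2),
    [/\ supported s M, bounded_by p1 p2 (A / (2 * k) ^+ L) (Z - PT U V M) &
        opb (A / (4 * k)) (M - PT U V M)]).
Proof.
move=> N0 q0 be0 k1 hq p10 p20 hp1 hp2 hU hV hu hv.
have T0 : (0 < #|{: 'I_n1 * 'I_n2}|)%N by rewrite card_prod !card_ord.
have k0 : 0 < k by exact: lt_le_trans k1.
have e0 : 0 <= batch_err n1 n2 r l by rewrite /batch_err !mulr_ge0 ?expR_ge0.
elim=> [|L IH] A Z A0 ZT hZ.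
  rewrite mul0r subr0 mul0n /Pseq /= asboolT //; exists 0; split=> //.
  - by move=> i j _; rewrite mxE.
  - by rewrite linear0 subr0 expr0 divr1.
  - by rewrite linear0 subr0; exact: opb0.
rewrite -natr1 mulrDl mul1r [_ + batch_err _ _ _ _]addrC mulSn.
have A1 : 0 < A / (2 * k) by rewrite divr_gt0 ?mulr_gt0.
apply: (Pseq_cat T0 _ (golf_step N0 q0 be0 A0 k1 hq p10 p20 hp1 hp2 hU hV hu hv hZ)
  (Q := fun s s' => exists M : 'M[R]_(n1, n2),
    [/\ supported s' M,
        bounded_by p1 p2 (A / (2 * k) / (2 * k) ^+ L)
          (- PT U V (samp q s Z - Z) - PT U V M) &
        opb (A / (2 * k) / (4 * k)) (M - PT U V M)])).
- by rewrite mulr_ge0.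
- move=> s [_ hs]; apply: (IH _ _ A1); last exact: bounded_byN.
  by rewrite linearN /= PT_idem.
move=> s s' [hD hs] [M [sM bM oM]]; exists (samp q s Z + M); split.
- by apply: supportedD; [apply: supported_catl; exact: supported_samp|exact: supported_catr].
- have eA : A / (2 * k) / (2 * k) ^+ L = A / (2 * k) ^+ L.+1.
    by rewrite exprS [in RHS]invfM mulrA.
  move: bM; rewrite eA (linearD (PT U V) (samp q s Z) M) (linearB (PT U V)) /= ZT.
  by move: (PT U V (samp q s Z)) (PT U V M) => X Y; rewrite opprB opprD addrA.
- have -> : samp q s Z + M - PT U V (samp q s Z + M) =
     (samp q s Z - Z - PT U V (samp q s Z - Z)) + (M - PT U V M).
    rewrite (linearD (PT U V) (samp q s Z) M) (linearB (PT U V)) /= ZT; move: (PT U V (samp q s Z)) (PT U V M) => X Y.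
    rewrite (_ : _ - Z - (X - Z) = samp q s Z - X); last by rewrite opprB addrA subrK.
    by rewrite opprD addrACA.
  have d0 : 0 <= A / (8 * k) by rewrite divr_ge0 ?mulr_ge0 ?ltW.
  have d1 : 0 <= A / (2 * k) / (4 * k) by rewrite !divr_ge0 ?mulr_ge0 ?ltW.
  apply: (@opbW _ _ _ (A / (8 * k) + A / (2 * k) / (4 * k))).
  + exact: addr_ge0.
  + rewrite (_ : A / (4 * k) = A / (8 * k) + A / (8 * k)); last by field; rewrite gt_eqF.
    rewrite lerD2l (_ : A / (2 * k) / (4 * k) = A / (8 * k) / k); last by field; rewrite gt_eqF.
    by rewrite ler_pdivrMr // ler_peMr.
  + by apply: opbD => //; exact: opb_PTc.
Qed.

(** * Exact correction *)

Lemma dot_mxvec (R : realFieldType) m n (A B : 'M[R]_(m, n)) :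
  dot (mxvec A) (mxvec B) = dot A B.
Proof.
rewrite !dotE big_ord1 (reindex _ (curry_mxvec_bij m n)) /= pair_bigA /=.
by apply: eq_bigr => -[i j] _; rewrite !mxvecE.
Qed.

Lemma dot_delta (R : realFieldType) m n (A : 'M[R]_(m, n)) i j :
  dot (delta_mx i j) A = A i j.
Proof.
rewrite dotE (bigD1 i) //= (bigD1 j) //= mxE !eqxx mul1r big1 => [|k kj].
  rewrite addr0 big1 ?addr0 // => k ki; rewrite big1 // => k' _.
  by rewrite mxE (negbTE ki) mul0r.
by rewrite mxE (negbTE kj) andbF mul0r.
Qed.

Lemma dot_mul_delta (R : realFieldType) m n p (A : 'M[R]_(m, n)) i (j : 'I_p) :
  dot (A *m delta_mx i j) (A *m delta_mx i j) = dot (col i A) (col i A).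
Proof.
have -> : delta_mx i j = delta_mx i 0 *m (delta_mx 0 j : 'M[R]_(1, p)).
  by rewrite mul_delta_mx.
rewrite mulmxA dot_mulr -[_ *m delta_mx 0 j *m _]mulmxA trmx_delta mul_delta_mx.
have -> : delta_mx 0 0 = 1%:M :> 'M[R]_1 by apply/matrixP => a b; rewrite !ord1 !mxE.
by rewrite mulmx1 colE.
Qed.

(** Expanding P_T leaves |row i U|^2 + |row j V|^2 minus a square. For orthonormal factors the left
    side is the squared norm of P_T e_ij, the leverage of the entry in the tangent space. *)
Lemma PT_delta_le (R : realFieldType) n1 n2 r (U : 'M[R]_(n1, r)) (V : 'M[R]_(n2, r))
    (p1 p2 : R) i j :
  dot (row i U) (row i U) <= p1 -> dot (row j V) (row j V) <= p2 ->
  dot (delta_mx i j) (PT U V (delta_mx i j)) <= p1 + p2.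
Proof.
move=> hu hv; set D := delta_mx i j; rewrite /PT dotBr dotDr.
have -> : dot D (U *m U^T *m D) = dot (row i U) (row i U).
  by rewrite -mulmxA dot_mull dot_mul_delta -row_trmx_col trmxK.
have -> : dot D (D *m (V *m V^T)) = dot (row j V) (row j V).
  rewrite mulmxA dot_mulr trmxK -dot_trmx trmx_mul trmx_delta dot_mul_delta.
  by rewrite -row_trmx_col trmxK.
have -> : dot D (U *m U^T *m D *m (V *m V^T)) = dot (U^T *m D *m V) (U^T *m D *m V).
  by rewrite mulmxA dot_mulr trmxK -!mulmxA dot_mull.
by have := dot_ge0 (U^T *m D *m V); lra.
Qed.

Lemma samp_entry (R : realType) n1 n2 q s (Z : 'M[R]_(n1, n2)) i j :
  samp q s Z i j = q%:R^-1 * ((count_mem (i, j) s)%:R * ((n1 * n2)%:R * Z i j)).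
Proof.
rewrite /samp mxE summxE; congr (_ * _).
elim: s => [|t s IH] /=; first by rewrite big_nil mul0r.
rewrite big_cons IH natrD mulrDl !mxE; congr (_ + _).
case: t => a b /=; rewrite xpair_eqE (eq_sym a) (eq_sym b).
case: (eqVneq i a) => [->|]; case: (eqVneq j b) => [->|] //=;
  by rewrite ?mul0r ?mulr0 ?mulr1 ?mul1r.
Qed.

Lemma samp_linear (R : realType) n1 n2 q s : linear (@samp R n1 n2 q s).
Proof.
by move=> a X Y; apply/matrixP => i j; rewrite [RHS]mxE [X in _ = X + _]mxE !samp_entry !mxE; ring.
Qed.

HB.instance Definition _ (R : realType) n1 n2 q s :=
  GRing.isLinear.Build R 'M[R]_(n1, n2) 'M[R]_(n1, n2) *:%R (@samp R n1 n2 q s)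
    (@samp_linear R n1 n2 q s).

Lemma dot_samp (R : realType) n1 n2 q s (Z : 'M[R]_(n1, n2)) :
  dot Z (samp q s Z) = q%:R^-1 * \sum_(t <- s) (n1 * n2)%:R * Z t.1 t.2 ^+ 2.
Proof.
rewrite /samp dotZr dot_sumr; congr (_ * _); apply: eq_bigr => t _.
by rewrite dotZr dotC dot_delta expr2 mulrA.
Qed.

(** On matrices read as vectors, P_T samp P_T is an average of operators N u u^T with u = P_T e_ij,
    of mean P_T. As N |u|^2 <= 2 be, [batch_concentration] applies with a = 2; the deviation is at
    most 2 / (8k) <= 1/4, whence <Z, samp q s Z> >= 3/4 |Z|^2 on T. *)
Lemma samp_coercive (R : realType) n1 n2 r (U : 'M[R]_(n1, r)) (V : 'M[R]_(n2, r))
    (p1 p2 be k l : R) q (N := (n1 * n2)%:R : R) :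
  (0 < n1 * n2)%N -> (0 < q)%N -> 0 < be -> 1 <= k ->
  2 ^+ 17 * k ^+ 2 * be * l <= q%:R ->
  N * p1 <= be -> N * p2 <= be ->
  U^T *m U = 1%:M -> V^T *m V = 1%:M ->
  (forall i, dot (row i U) (row i U) <= p1) ->
  (forall j, dot (row j V) (row j V) <= p2) ->
  1 - 2 * (n1 * n2 + n1 * n2)%:R * expR (- (32 * l)) <=
  Pseq R q (fun s => forall Z : 'M[R]_(n1, n2), PT U V Z = Z ->
    dot Z Z <= 2 * dot Z (samp q s Z)).
Proof.
move=> N0 q0 be0 k1 hq hp1 hp2 hU hV hu hv.
have T0 : (0 < #|{: 'I_n1 * 'I_n2}|)%N by rewrite card_prod !card_ord.
have N0' : 0 < N by rewrite ltr0n.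
pose u (t : 'I_n1 * 'I_n2) := mxvec (PT U V (delta_mx t.1 t.2)).
pose Y t := N *: ((u t)^T *m u t).
have u2 t : N * dot (u t) (u t) <= 2 * be.
  rewrite /u dot_mxvec -dot_PT PT_idem //.
  apply: le_trans (_ : N * (p1 + p2) <= _); last by rewrite mulrDr; lra.
  by apply: ler_wpM2l; [exact: ltW|exact: PT_delta_le].
have ux t (x : 'cV[R]_(n1 * n2)) :
    u t *m x = ((PT U V (vec_mx x^T)) t.1 t.2)%:M.
  rewrite [LHS]mx11_scalar; congr (_%:M).
  rewrite -dot_delta dot_PT -dot_mxvec vec_mxK dotC /dot trmxK.
  by rewrite mxtrace_mulC /mxtrace big_ord1.
have Yx t (x : 'cV[R]_(n1 * n2)) :
    Y t *m x = (N * (PT U V (vec_mx x^T)) t.1 t.2) *: (u t)^T.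
  by rewrite /Y -scalemxAl -mulmxA ux mul_mx_scalar scalerA.
have YT t : (Y t)^T = Y t by rewrite /Y linearZ /= trmx_mul trmxK.
have sum_PT (x : 'cV[R]_(n1 * n2)) :
    \sum_(t : 'I_n1 * 'I_n2) PT U V (vec_mx x^T) t.1 t.2 ^+ 2 <= dot x x.
  rewrite -dot_trmx -[x^T]vec_mxK dot_mxvec mxvecK.
  by apply: le_trans (dot_PT_le _ hU hV); rewrite dotE pair_bigA.
have dYx t (x : 'cV[R]_(n1 * n2)) : dot (Y t *m x) (Y t *m x) =
   N * (N * dot (u t) (u t)) * PT U V (vec_mx x^T) t.1 t.2 ^+ 2.
  by rewrite Yx dotZl dotZr dot_trmx; ring.
have var (x : 'cV[R]_(n1 * n2)) :
    avg (fun t => dot (Y t *m x) (Y t *m x)) <= be * 2 ^+ 2 * dot x x.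
  apply: le_trans (_ : avg (fun t => (2 * be * N) * PT U V (vec_mx x^T) t.1 t.2 ^+ 2) <= _).
    apply: avg_le => t; rewrite dYx [N * (N * _)]mulrC.
    by apply: ler_wpM2r; rewrite ?sqr_ge0 // ler_wpM2r // ltW.
  rewrite avgZ /avg card_prod !card_ord -/N mulrA mulfK ?gt_eqF //.
  have := sum_PT x; have := dot_ge0 x; nra.
apply: le_trans (@batch_concentration R _ _ _ Y (#|{: 'I_n1 * 'I_n2}|%:R^-1 *: \sum_t Y t)
  be 2 k l q T0 q0 be0 _ k1 hq _ erefl var _) _ => //.
- move=> t x; rewrite dYx exprMn.
  have : PT U V (vec_mx x^T) t.1 t.2 ^+ 2 <= dot (u t) (u t) * dot x x.
    have := coord_sqr_le (u t) x 0; rewrite ux mxE eqxx mulr1n.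
    by have -> : row 0 (u t) = u t by apply/rowP => j; rewrite mxE.
  have := u2 t; set a := dot (u t) (u t); set c := _ ^+ 2 => h1 h2.
  have a0 : 0 <= a by exact: dot_ge0.
  have x0 := dot_ge0 x.
  apply: le_trans (_ : N * (N * a) * (a * dot x x) <= _).
    by apply: ler_wpM2l => //; rewrite !mulr_ge0 // ltW.
  rewrite (_ : N * (N * a) * (a * dot x x) = (N * a) ^+ 2 * dot x x); last by ring.
  rewrite -exprMn (mulrC be); apply: ler_wpM2r => //.
  by apply: lerXn2r; rewrite ?nnegrE ?mulr_ge0 // ltW.
- by move=> x; under eq_avg do rewrite YT; exact: var.
apply: Pseq_le => s _ hs Z ZT.
pose x := (mxvec Z)^T; have xZ : vec_mx x^T = Z by rewrite trmxK mxvecK.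
have xx : dot x x = dot Z Z by rewrite dot_trmx dot_mxvec.
have d0 : 0 <= 2 / (8 * k) by rewrite divr_ge0 ?mulr_ge0 // (le_trans ler01).
have hs' : opb (2 / (8 * k)) (- (q%:R^-1 *: (\sum_(t <- s) Y t) -
    #|{: 'I_n1 * 'I_n2}|%:R^-1 *: \sum_t Y t)) by exact: opbN.
have := opb_dot x d0 hs'.
have xYx t : dot x (Y t *m x) = N * Z t.1 t.2 ^+ 2.
  rewrite Yx xZ ZT dotZr dot_trmx /u dot_mxvec dot_PT ZT dotC dot_delta; ring.
rewrite dot_samp mulNmx dotNr mulmxBl dotBr -!scalemxAl !dotZr !mulmx_suml !dot_sumr.
rewrite xx; under eq_bigr do rewrite xYx.
under [X in _ - _ * X]eq_bigr do rewrite xYx.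
rewrite -[X in _ - _ * X]mulr_sumr card_prod !card_ord -/N mulKf ?gt_eqF //.
have -> : \sum_(t : 'I_n1 * 'I_n2) Z t.1 t.2 ^+ 2 = dot Z Z by rewrite dotE pair_bigA.
have k0 : 0 < k by exact: lt_le_trans k1.
have : 2 / (8 * k) * dot Z Z <= 4^-1 * dot Z Z.
  apply: ler_wpM2r; first exact: dot_ge0.
  by rewrite ler_pdivrMr ?mulr_gt0 //; lra.
have := dot_ge0 Z; lra.
Qed.

Lemma linear_inj_surj (F : fieldType) m n (f : {linear 'M[F]_(m, n) -> 'M[F]_(m, n)}) :
  (forall X, f X = 0 -> X = 0) -> forall Y, exists X, f X = Y.
Proof.
move=> hf Y.
have hu : lin_mx f \in unitmx.
  rewrite -row_free_unit; apply: inj_row_free => v hv.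
  have := hf (vec_mx v); rewrite -[v]vec_mxK mul_vec_lin in hv.
  move=> h; rewrite -[v]vec_mxK h ?linear0 //.
  by rewrite -[LHS]mxvecK hv linear0.
exists (vec_mx (mxvec Y *m invmx (lin_mx f))).
by rewrite -[LHS]mxvecK -mul_vec_lin vec_mxK -mulmxA mulVmx // mulmx1 mxvecK.
Qed.

(* Adding the identity on the orthogonal complement of T makes the compression
   of [samp] to T invertible on all matrices. *)
Definition comp_samp (R : realType) n1 n2 r (U : 'M[R]_(n1, r)) (V : 'M[R]_(n2, r)) q s
    (Z : 'M[R]_(n1, n2)) : 'M[R]_(n1, n2) :=
  PT U V (samp q s (PT U V Z)) + (Z - PT U V Z).

Lemma comp_samp_linear (R : realType) n1 n2 r (U : 'M[R]_(n1, r)) (V : 'M[R]_(n2, r)) q s :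
  linear (comp_samp U V q s).
Proof.
move=> a X Y; rewrite /comp_samp !(linearP (PT U V)) !(linearP (samp q s)) (linearP (PT U V)).
rewrite scalerDr [RHS]addrACA; congr (_ + _).
by rewrite scalerBr opprD addrACA.
Qed.

HB.instance Definition _ (R : realType) n1 n2 r (U : 'M[R]_(n1, r)) (V : 'M[R]_(n2, r)) q s :=
  GRing.isLinear.Build R 'M[R]_(n1, n2) 'M[R]_(n1, n2) *:%R (comp_samp U V q s)
    (comp_samp_linear U V q s).

(** Coercivity makes [comp_samp] injective, hence onto; this provides Z in T with P_T (samp q s Z) =
    W, and M = samp q s Z. Since [samp] multiplies each entry by a number in [0, n1 n2], |M|^2 <= n1
    n2 <Z, samp q s Z> = n1 n2 <Z, W>, and |Z|^2 <= 2 <Z, W> forces <Z, W> <= 2 |W|^2. *)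
Lemma samp_correction (R : realType) n1 n2 r (U : 'M[R]_(n1, r)) (V : 'M[R]_(n2, r))
    q s (W : 'M[R]_(n1, n2)) :
  U^T *m U = 1%:M -> V^T *m V = 1%:M -> (0 < q)%N -> size s = q ->
  (forall Z : 'M[R]_(n1, n2), PT U V Z = Z -> dot Z Z <= 2 * dot Z (samp q s Z)) ->
  PT U V W = W ->
  exists M : 'M[R]_(n1, n2),
    [/\ supported s M, PT U V M = W & dot M M <= 2 * (n1 * n2)%:R * dot W W].
Proof.
move=> hU hV q0 hs hc WT.
have q0' : (0 : R) < q%:R by rewrite ltr0n.
have PTG Z : PT U V (comp_samp U V q s Z) = PT U V (samp q s (PT U V Z)).
  rewrite /comp_samp (linearD (PT U V) (PT U V _)) (linearB (PT U V) Z) /= !PT_idem //.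
  by rewrite subrr addr0.
have dPT Z Y : PT U V Z = Z -> dot Z Y = dot Z (PT U V Y) by rewrite dot_PT => ->.
have [Z' hZ] : exists Z', comp_samp U V q s Z' = W.
  apply: linear_inj_surj => Z hZ.
  have e1 := PTG Z; rewrite hZ linear0 in e1.
  have e2 : Z = PT U V Z.
    by apply/eqP; rewrite -subr_eq0; move/eqP: hZ; rewrite /= /comp_samp -e1 add0r.
  rewrite -e2 in e1.
  have := hc Z (esym e2); rewrite (dPT _ (samp q s Z) (esym e2)) -e1 dot0r mulr0 => h.
  by apply: dot_eq0; apply/le_anti; rewrite h dot_ge0.
have hW := PTG Z'; rewrite hZ WT in hW.
set Z := PT U V Z' in hW.
have ZT : PT U V Z = Z by rewrite PT_idem.
have zW : dot Z (samp q s Z) = dot Z W by rewrite (dPT _ _ ZT) -hW.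
exists (samp q s Z); split; [exact: supported_samp|by rewrite -hW|].
have h1 := hc Z ZT; rewrite zW in h1.
have cs := cauchy_schwarz Z W.
have z0 := dot_ge0 Z; have w0 := dot_ge0 W.
have zz : dot Z Z <= 4 * dot W W.
  have [->|zn] := eqVneq Z 0; first by rewrite dot0l mulr_ge0.
  have zp := dot_gt0 zn; rewrite -(ler_pM2l zp); nra.
have zw : dot Z W <= 2 * dot W W.
  have := dot_le_mean Z (2 *: W); rewrite dotZr dotZl dotZr mulr2n; lra.
apply: le_trans (_ : (n1 * n2)%:R * dot Z (samp q s Z) <= _); last first.
  by rewrite zW (mulrC 2) -mulrA; apply: ler_wpM2l.
rewrite !dotE mulr_sumr; apply: ler_sum => i _; rewrite mulr_sumr; apply: ler_sum => j _.
rewrite samp_entry; set c := (count_mem _ _)%:R; set N := (n1 * n2)%:R.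
have c0 : 0 <= c by exact: ler0n.
have cq : c <= q%:R by rewrite ler_nat -hs count_size.
have N0 : 0 <= N by exact: ler0n.
(* The fraction of the samples equal to (i, j), at most 1 because [s] has exactly [q] elements. *)
set y := q%:R^-1 * c.
have y0 : 0 <= y by rewrite mulr_ge0 // invr_ge0 ltW.
have y1 : y <= 1 by rewrite ler_pdivrMl // mulr1.
have -> : q%:R^-1 * (c * (N * Z i j)) * (q%:R^-1 * (c * (N * Z i j))) =
  (N ^+ 2 * Z i j ^+ 2 * y) * y by rewrite /y; ring.
have -> : N * (Z i j * (q%:R^-1 * (c * (N * Z i j)))) = N ^+ 2 * Z i j ^+ 2 * y.
  by rewrite /y; ring.
apply: ler_piMr => //; apply: mulr_ge0 => //; apply: mulr_ge0; exact: sqr_ge0.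
Qed.

(** * Certificates *)

Lemma mxtrace_proj (R : realFieldType) n k (C : 'M[R]_(k, n)) :
  C *m C^T \in unitmx ->
  \tr (C^T *m invmx (C *m C^T) *m C) = k%:R.
Proof.
by move=> h; rewrite -mulmxA mxtrace_mulC -mulmxA mulVmx // mxtrace1.
Qed.

Lemma gram_unit (R : realFieldType) n k (C : 'M[R]_(k, n)) :
  row_free C -> C *m C^T \in unitmx.
Proof.
move=> hC; rewrite -row_free_unit; apply: inj_row_free => v hv.
have : dot (v *m C) (v *m C) = 0.
  by rewrite dot_mulr -mulmxA hv dot0l.
move=> /dot_eq0 h; apply: (row_free_inj hC); by rewrite h mul0mx.
Qed.

(** A basis C of the row space need not be orthonormalised: C^T (C C^T)^(-1) C is the orthogonal
    projector and its trace is the rank. The inner dimension of a competing factorization enters the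
    uniqueness argument through this trace. *)
Lemma row_projector (R : realFieldType) n1 n2 r (A : 'M[R]_(n1, r)) (B : 'M[R]_(r, n2)) :
  exists Q : 'M[R]_n2,
    [/\ Q^T = Q, Q *m Q = Q, A *m B *m Q = A *m B & \tr Q <= r%:R].
Proof.
have [k [C [hC [D hD] hk]]] : exists k (C : 'M[R]_(k, n2)),
    [/\ row_free C, exists D, A *m B = D *m C & (k <= r)%N].
  exists (\rank (A *m B)), (row_base (A *m B)); split.
  - exact: row_base_free.
  - by apply/submxP; rewrite eq_row_base.
  - by apply: leq_trans (mxrankM_maxl _ _) _; exact: rank_leq_col.
have hu := gram_unit hC.
have e : C *m (C^T *m (invmx (C *m C^T) *m C)) = C by rewrite mulmxA mulKVmx.
exists (C^T *m invmx (C *m C^T) *m C); split.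
- by rewrite !trmx_mul trmxK trmx_inv trmx_mul trmxK mulmxA.
- by rewrite -!mulmxA e.
- by rewrite hD -!mulmxA e.
- by rewrite mxtrace_proj // ler_nat.
Qed.

Lemma dot_diag_mx (R : realFieldType) r n (s : 'rV[R]_r) (M : 'M[R]_(r, n)) :
  dot (diag_mx s *m M) (diag_mx s *m M) =
  \sum_i s 0 i ^+ 2 * dot (row i M) (row i M).
Proof.
rewrite dotE; apply: eq_bigr => i _; rewrite dot_row mulr_sumr.
by apply: eq_bigr => j _; rewrite mul_diag_mx !mxE; ring.
Qed.

Lemma dot_rows (R : realFieldType) r n (M : 'M[R]_(r, n)) :
  dot M M = \sum_i dot (row i M) (row i M).
Proof. by rewrite dotE; apply: eq_bigr => i _; rewrite dot_row. Qed.

(** Losing the share 1 - c_i of direction i costs (s_i^2 - t^2)(1 - c_i) >= 0. The hypothesis makes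
    the total cost at most 0, so each term vanishes, and s_i > t leaves c_i = 1. *)
Lemma defect_eq1 (R : realFieldType) r (s : 'rV[R]_r) (c : 'I_r -> R) (t : R) :
  0 <= t -> (forall i, t < s 0 i) -> (forall i, c i <= 1) ->
  \sum_i s 0 i ^+ 2 <= \sum_i (s 0 i ^+ 2 * c i + t ^+ 2 * (1 - c i)) ->
  forall i, c i = 1.
Proof.
move=> t0 ts c1 h.
have pos i : 0 < s 0 i ^+ 2 - t ^+ 2 by rewrite subr_gt0 ltrXn2r // ?nnegrE // ltW // (le_lt_trans t0).
have h0 i : 0 <= (s 0 i ^+ 2 - t ^+ 2) * (1 - c i).
  by apply: mulr_ge0; [exact: ltW|rewrite subr_ge0].
have : \sum_i (s 0 i ^+ 2 - t ^+ 2) * (1 - c i) <= 0.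
  rewrite (eq_bigr (fun i => s 0 i ^+ 2 - (s 0 i ^+ 2 * c i + t ^+ 2 * (1 - c i)))).
    by rewrite sumrB subr_le0.
  by move=> i _; ring.
move=> h1 i; have /eqP : \sum_i (s 0 i ^+ 2 - t ^+ 2) * (1 - c i) = 0.
  by apply/le_anti; rewrite h1 sumr_ge0.
rewrite psumr_eq0 // => /allP /(_ i (mem_index_enum _)) /=.
by rewrite mulf_eq0 gt_eqF //= subr_eq0 => /eqP.
Qed.

(* Ky Fan: a projector of rank at most [r] captures at most the energy of the
   [r] leading singular directions, which are those of [X]. *)
Lemma certificate_energy (R : realType) n1 n2 r (U : 'M[R]_(n1, r)) (V : 'M[R]_(n2, r))
    (s : 'rV[R]_r) (W : 'M[R]_(n1, n2)) (Q : 'M[R]_n2) (t : R)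
    (X := U *m diag_mx s *m V^T) :
  U^T *m U = 1%:M -> V^T *m V = 1%:M -> 0 <= t -> (forall i, t < s 0 i) ->
  U^T *m W = 0 -> W *m V = 0 -> opb t W ->
  Q^T = Q -> Q *m Q = Q -> \tr Q <= r%:R ->
  [/\ dot ((X + W) *m Q) ((X + W) *m Q) = dot (X *m Q) (X *m Q) + dot (W *m Q) (W *m Q),
      dot ((X + W) *m Q) ((X + W) *m Q) <= dot X X &
      (dot X X <= dot ((X + W) *m Q) ((X + W) *m Q) -> V^T *m Q = V^T)].
Proof.
move=> hU hV t0 ts UW WV hW QT QQ trQ.
have e1 : dot ((X + W) *m Q) ((X + W) *m Q) = dot (X *m Q) (X *m Q) + dot (W *m Q) (W *m Q).
  have z : dot (X *m Q) (W *m Q) = 0.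
    by rewrite dotC /X -!mulmxA dot_mull (mulmxA U^T) UW mul0mx dot0l.
  by rewrite mulmxDl dotDl !dotDr (dotC (W *m Q) (X *m Q)) z addr0 add0r.
pose c i := dot (row i (V^T *m Q)) (row i (V^T *m Q)).
have XX : dot X X = \sum_i s 0 i ^+ 2.
  rewrite /X dot_mulr trmxK -(mulmxA _ V^T V) hV mulmx1 dot_mull (mulmxA U^T) hU mul1mx.
  rewrite -[diag_mx s]mulmx1 dot_diag_mx; apply: eq_bigr => i _.
  by rewrite -[1%:M]trmx1 row_trmx_col colE mul1mx dot_delta mxE !eqxx mulr1.
have XQ : dot (X *m Q) (X *m Q) = \sum_i s 0 i ^+ 2 * c i.
  by rewrite /X -!mulmxA dot_mull (mulmxA U^T) hU mul1mx dot_diag_mx.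
have cs : dot (V^T *m Q) (V^T *m Q) = \sum_i c i by rewrite dot_rows.
have oQ : opb 1 Q.
  move=> x; rewrite expr1n mul1r -subr_ge0.
  have -> : dot x x - dot (Q *m x) (Q *m x) = dot (x - Q *m x) (x - Q *m x).
    have e : dot x (Q *m x) = dot (Q *m x) (Q *m x) by rewrite [RHS]dot_mull QT mulmxA QQ dotC.
    by rewrite dotBl !dotBr (dotC (Q *m x) x) e; ring.
  exact: dot_ge0.
have c1 i : c i <= 1.
  rewrite /c row_mul -dot_trmx trmx_mul QT; apply: le_trans (oQ _) _.
  rewrite expr1n mul1r dot_trmx row_trmx_col colE dot_mull mulmxA hV mul1mx.
  by rewrite dot_delta mxE !eqxx.
(* W kills the range of V, so W Q = W (1 - V V^T) Q. The squared norm of (1 - V V^T) Q is tr Q minus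
   the sum of the c_i; here tr Q <= r is used. *)
have WQ : dot (W *m Q) (W *m Q) <= t ^+ 2 * \sum_i (1 - c i).
  have -> : W *m Q = W *m ((1%:M - V *m V^T) *m Q).
    by rewrite mulmxA mulmxBr mulmx1 mulmxA WV mul0mx subr0.
  apply: le_trans (opb_mx _ hW) _; apply: ler_wpM2l; first exact: sqr_ge0.
  rewrite dot_mull proj_compl_tr mulmxA proj_compl_idem // mulmxBl mul1mx dotBl.
  have -> : dot Q Q = \tr Q by rewrite /dot QT QQ.
  by rewrite dotC -mulmxA dot_mull cs sumrB sumr_const card_ord lerD2r.
have tot : dot ((X + W) *m Q) ((X + W) *m Q) <=
    \sum_i (s 0 i ^+ 2 * c i + t ^+ 2 * (1 - c i)).
  by rewrite e1 XQ big_split -mulr_sumr /= lerD2l.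
split=> //.
- apply: le_trans tot _; rewrite XX; apply: ler_sum => i _.
  have : t ^+ 2 <= s 0 i ^+ 2.
    by apply: lerXn2r; rewrite ?nnegrE // ltW // (le_lt_trans t0).
  have := c1 i; nra.
move=> h; rewrite XX in h.
have ci := defect_eq1 t0 ts c1 (le_trans h tot).
apply/eqP; rewrite -subr_eq0; apply/eqP/dot_eq0.
have e : dot V^T (V^T *m Q) = dot (V^T *m Q) (V^T *m Q).
  by rewrite [RHS]dot_mulr QT -mulmxA QQ dotC.
have eV : dot V^T V^T = r%:R by rewrite dot_trmx /dot hV mxtrace1.
rewrite dotBl !dotBr (dotC (V^T *m Q) V^T) e eV cs.
under eq_bigr do rewrite ci.
by rewrite sumr_const card_ord; ring.
Qed.

Lemma normF_sqr (R : realType) n1 n2 (A : 'M[R]_(n1, n2)) : normF A ^+ 2 = dot A A.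
Proof. by rewrite /normF sqr_sqrtr ?dotE //; have := dot_ge0 A; rewrite dotE. Qed.

Lemma objective_le (R : realType) n1 n2 r (A A' : 'M[R]_(n1, r)) (B B' : 'M[R]_(r, n2)) :
  (objective A B <= objective A' B') = (dot (A *m B) (A *m B) <= dot (A' *m B') (A' *m B')).
Proof. by rewrite /objective !normF_sqr ler_pM2l // invr_gt0. Qed.

Lemma PT_svd (R : realType) n1 n2 r (U : 'M[R]_(n1, r)) (V : 'M[R]_(n2, r)) M :
  U^T *m U = 1%:M -> PT U V (U *m M *m V^T) = U *m M *m V^T.
Proof.
move=> hU; rewrite PTE mulmxBl mul1mx -!mulmxA (mulmxA U^T) hU mul1mx subrr mul0mx.
by rewrite subr0.
Qed.

Lemma certificate_unique (R : realType) n1 n2 r (X : 'M[R]_(n1, n2))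
    (U : 'M[R]_(n1, r)) (s : 'rV[R]_r) (V : 'M[R]_(n2, r))
    (Omega : {set 'I_n1 * 'I_n2}) (Y : 'M[R]_(n1, n2)) (t : R) :
  (0 < r)%N -> skinny_svd X U s V ->
  (forall i j, (i, j) \notin Omega -> Y i j = 0) ->
  PT U V Y = X -> 0 <= t -> (forall i, t < s 0 i) -> opb t (Y - X) ->
  unique_solution r X Omega.
Proof.
move=> r0 [hU hV s0 _ hX] hY YX t0 ts hW.
set W := Y - X in hW.
have XT : PT U V X = X by rewrite {1}hX PT_svd // -hX.
have eW : W = (1%:M - U *m U^T) *m Y *m (1%:M - V *m V^T).
  by rewrite /W -{1}YX PTE opprB addrC subrK.
have UW : U^T *m W = 0.
  have e : U^T *m (1%:M - U *m U^T) = 0 by rewrite mulmxBr mulmx1 mulmxA hU mul1mx subrr.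
  by rewrite eW !mulmxA e !mul0mx.
have WV : W *m V = 0.
  have e : (1%:M - V *m V^T) *m V = 0 by rewrite mulmxBl mul1mx -mulmxA hV mulmx1 subrr.
  by rewrite eW -(mulmxA _ (1%:M - V *m V^T) V) e mulmx0.
have XY : Y = X + W by rewrite addrC subrK.
(* Strict positivity is what allows |X|^2 to be cancelled from |X|^4 <= |Y Q|^2 |Z|^2. *)
have XX0 : 0 < dot X X.
  apply: dot_gt0; apply: contraTneq r0 => X0; rewrite -eqn0Ngt; apply/eqP.
  case: r U s V hU hV s0 hX {ts YX XT eW UW WV} => // r U s V hU hV s0 hX.
  have : U^T *m X *m V = diag_mx s.
    by rewrite hX -!mulmxA hV mulmx1 mulmxA hU mul1mx.
  rewrite X0 mulmx0 mul0mx => /matrixP /(_ ord0 ord0).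
  by rewrite !mxE eqxx mulr1n => h; have := s0 ord0; rewrite -h ltxx.
have key (A : 'M[R]_(n1, r)) (B : 'M[R]_(r, n2)) : feasible X Omega A B ->
    dot X X <= dot (A *m B) (A *m B) /\
    (dot (A *m B) (A *m B) <= dot X X -> A *m B = X).
  move=> /matrixP fe; set Z := A *m B.
  have [Q [QT QQ ZQ trQ]] := row_projector A B; rewrite -/Z in ZQ.
  (* Z and X can differ only off Omega, where Y vanishes; and X lies in T, so <Y, X> = <P_T Y, X> =
     |X|^2. *)
  have YZ : dot Y Z = dot X X.
    transitivity (dot Y X).
      rewrite !dotE; apply: eq_bigr => i _; apply: eq_bigr => j _.
      have := fe i j; rewrite !mxE -/Z; case: ifPn => [_ -> //|/hY ->].
      by rewrite !mul0r.
    by rewrite -{1}XT dot_PT YX.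
  have := certificate_energy hU hV t0 ts UW WV hW QT QQ trQ; rewrite -hX -XY.
  move=> [e1 e2 e3].
  have YQZ : dot (Y *m Q) Z = dot X X by rewrite -YZ -{2}ZQ dot_mulr QT.
  have cs := cauchy_schwarz (Y *m Q) Z; rewrite YQZ in cs.
  set a := dot (Y *m Q) (Y *m Q) in cs e1 e2 e3.
  have z0 := dot_ge0 Z; have a0 : 0 <= a by exact: dot_ge0.
  have XZ : dot X X <= dot Z Z.
    rewrite -(ler_pM2l XX0); apply: le_trans (_ : a * dot Z Z <= _); first by rewrite -expr2.
    by rewrite ler_wpM2r.
  split=> // ZX; have ZZ : dot Z Z = dot X X by apply/le_anti; rewrite ZX XZ.
  have aX : dot X X <= a.
    by rewrite -(ler_pM2r XX0) -expr2; apply: le_trans cs _; rewrite ZZ.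
  have VQ := e3 aX.
  have ea : a = dot X X by apply/le_anti; rewrite aX e2.
  (* The equality case of Cauchy-Schwarz. Then Q fixes X, the energy identity leaves nothing for W
     Q, and Y Q reduces to X. *)
  have ZY : Z = Y *m Q.
    apply/eqP; rewrite -subr_eq0; apply/eqP/dot_eq0.
    by rewrite dotBl !dotBr (dotC Z (Y *m Q)) YQZ -/a ea ZZ; ring.
  have XQ : X *m Q = X by rewrite hX -!mulmxA VQ.
  have WQ : W *m Q = 0.
    by apply: dot_eq0; move: e1; rewrite XQ ea => /eqP; rewrite addrC -subr_eq subrr => /eqP.
  by rewrite ZY XY mulmxDl XQ WQ addr0.
have fX : feasible X Omega (U *m diag_mx s) V^T by rewrite /feasible -hX.
split.
  exists (U *m diag_mx s), V^T; split; last by rewrite -hX.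
  by split=> // A' B' /key [h _]; rewrite objective_le -hX.
move=> A B [fe op]; have [_ h] := key A B fe; apply: h.
by have := op _ _ fX; rewrite objective_le -hX.
Qed.

(** * From sequences to subsets *)

Lemma superset_card (T : finType) (A : {set T}) m :
  (#|A| <= m)%N -> (m <= #|T|)%N -> exists2 S : {set T}, A \subset S & #|S| = m.
Proof.
move=> Am mT; elim: m Am mT => [|m IH] Am mT.
  by exists A => //; apply/eqP; rewrite -leqn0.
move: Am; rewrite leq_eqVlt => /orP [/eqP <-|Am]; first by exists A.
have [S AS Sm] := IH Am (ltnW mT).
have [x xS] : exists x, x \notin S.
  apply/existsP; apply: contraTT mT; rewrite negb_exists -leqNgt => /forallP h.
  rewrite -Sm; apply: subset_leq_card; apply/subsetP => y _.
  by have := h y; rewrite negbK.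
exists (x |: S); first by apply: subset_trans AS _; exact: subsetUr.
by rewrite cardsU1 xS Sm.
Qed.

Definition perm_sum (R : realType) (T : finType) (f : {set T} -> R) (S : {set T}) : R :=
  \sum_(p : {perm T}) f (p @: S).

Lemma perm_sum_tperm (R : realType) (T : finType) (f : {set T} -> R) (S : {set T}) (a b : T) :
  perm_sum f (tperm a b @: S) = perm_sum f S.
Proof.
rewrite /perm_sum [RHS](reindex_inj (mulgI (tperm a b))) /=.
apply: eq_bigr => p _; congr f; rewrite -imset_comp.
by apply: eq_imset => x; rewrite /= permM.
Qed.

(** A transposition exchanging an element of S \ S' with one of S' \ S does not change the sum over
    all permutations and brings S closer to S'. *)
Lemma perm_sum_card (R : realType) (T : finType) (f : {set T} -> R) (S S' : {set T}) :
  #|S| = #|S'| -> perm_sum f S = perm_sum f S'.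
Proof.
have [n] := ubnP #|S :\: S'|; elim: n S => // n IH S hn hS.
have [/eqP|/set0Pn [a]] := eqVneq (S :\: S') set0.
  rewrite setD_eq0 => sub; congr perm_sum; apply/eqP.
  by rewrite eqEcard sub hS leqnn.
rewrite inE => /andP [aS' aS].
have : (S' :\: S) != set0.
  apply: contraNneq aS' => /eqP; rewrite setD_eq0 => sub.
  have /eqP -> : S' == S by rewrite eqEcard sub hS leqnn.
  by [].
move=> /set0Pn [b]; rewrite inE => /andP [bS bS'].
rewrite -(perm_sum_tperm f S a b); apply: IH; last first.
  by rewrite card_imset //; exact: perm_inj.
apply: (@leq_trans #|S :\: S'|); last by rewrite -ltnS.
have sub : (tperm a b @: S) :\: S' \proper S :\: S'.
  apply/properP; split.
    apply/subsetP => y; rewrite !inE => /andP [yS' /imsetP [x xS ey]].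
    rewrite yS' /=; move: ey; case: tpermP => [xa|xb|_ _] ey.
    - by move: yS'; rewrite ey bS'.
    - by move: bS; rewrite -xb xS.
    - by rewrite ey.
  exists a; rewrite !inE ?aS' ?aS //=; apply/negP => /imsetP [x xS].
  case: tpermP => [xa ab|xb _|xa _ ax].
  - by move: bS'; rewrite -ab (negbTE aS').
  - by move: bS; rewrite -xb xS.
  - by apply: xa; rewrite ax.
exact: proper_card sub.
Qed.

(** Double counting over pairs of an m-subset A and a permutation p: for fixed p the m-subsets are
    merely permuted, while for fixed A the sum over p does not depend on A. *)
Lemma perm_sum_prob (R : realType) (T : finType) (m : nat) (E : {set T} -> Prop)
    (S : {set T}) :
  #|S| = m ->
  #|{perm T}|%:R^-1 * perm_sum (fun A => (`[< E A >] : nat)%:R) S = prob_subset R m E.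
Proof.
move=> Sm; set f := fun A => _; set F := [set A : {set T} | #|A| == m].
have F0 : (0 < #|F|)%N by apply/card_gt0P; exists S; rewrite inE Sm.
have e : \sum_(A in F) perm_sum f A = #|{perm T}|%:R * \sum_(A in F) f A.
  rewrite /perm_sum exchange_big /= mulr_natl -sumr_const; apply: eq_bigr => p _.
  rewrite [RHS](reindex (fun A : {set T} => p @: A)) /=.
    by apply: eq_bigl => A; rewrite !inE card_imset //; exact: perm_inj.
  exists (fun A : {set T} => p^-1%g @: A) => A _; rewrite -imset_comp -[RHS]imset_id;
    by apply: eq_imset => x /=; rewrite ?permK ?permKV.
have e' : \sum_(A in F) perm_sum f A = #|F|%:R * perm_sum f S.
  rewrite mulr_natl -sumr_const; apply: eq_bigr => A; rewrite inE => /eqP Am.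
  by apply: perm_sum_card; rewrite Am Sm.
have P0 : (0 < #|{perm T}|)%N by apply/card_gt0P; exists 1%g.
have FR : #|F|%:R != 0 :> R by rewrite pnatr_eq0 -lt0n.
have PR : #|{perm T}|%:R != 0 :> R by rewrite pnatr_eq0 -lt0n.
have -> : perm_sum f S = #|F|%:R^-1 * (#|{perm T}|%:R * \sum_(A in F) f A).
  by rewrite -e e' mulKf.
rewrite mulrCA mulKf // /prob_subset mulrC; congr (_ * _).
rewrite /f -natr_sum; congr _%:R; rewrite -sum1_card [RHS]big_mkcond /=.
rewrite big_mkcond /=; apply: eq_bigr => A _; rewrite !inE.
by case: (#|A| == m) => //=; case: asboolP.
Qed.

(* The set of values of an i.i.d. sequence is invariant in law under permutations
   of [T]; given its size it is uniform. *)
Lemma Pseq_le_prob_subset (R : realType) (T : finType) (m N : nat) (E : {set T} -> Prop) :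
  (0 < #|T|)%N -> (N <= m)%N -> (m <= #|T|)%N ->
  (forall A B : {set T}, A \subset B -> E A -> E B) ->
  Pseq R N (fun s => E [set x in s]) <= prob_subset R m E.
Proof.
move=> T0 Nm mT mono.
have P0 : (0 < #|{perm T}|)%N by apply/card_gt0P; exists 1%g.
pose g (p : {perm T}) (s : seq T) : R := (`[< E (p @: [set x in s]) >] : nat)%:R.
have inv (p : {perm T}) : Pseq R N (fun s => E [set x in s]) = Eseq N (g p).
  rewrite -(@Pseq_bij R T T p N (fun s => E [set x in s])); last first.
    by exists (p^-1)%g; [exact: permK|exact: permKV].
  apply: eq_Eseq => s _; rewrite /g; do 3 congr _; congr (nat_of_bool (asbool (E _)))%:R.
  apply/setP => y; rewrite inE; apply/mapP/imsetP => -[x xs ->]; exists x => //;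
    by rewrite inE in xs *.
have -> : Pseq R N (fun s => E [set x in s]) =
    Eseq N (fun s => #|{perm T}|%:R^-1 * \sum_(p : {perm T}) g p s).
  rewrite EseqZ.
  have ex (r : seq {perm T}) : Eseq N (fun s => \sum_(p <- r) g p s) = \sum_(p <- r) Eseq N (g p).
    elim: r => [|p r IH].
      rewrite big_nil -[RHS](Eseq_cst N 0 T0); apply: eq_Eseq => s _; exact: big_nil.
    by rewrite big_cons -IH -EseqD; apply: eq_Eseq => s _; rewrite big_cons.
  rewrite ex; under eq_bigr do rewrite -inv.
  rewrite sumr_const -[X in _ * X]mulr_natl mulrA mulVf ?mul1r //.
  by rewrite pnatr_eq0 -lt0n.
rewrite -[leRHS](Eseq_cst N _ T0); apply: Eseq_le => s hs.
(* The values of [s] form a set of at most N <= m elements. It is padded to an m-set before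
   permuting; monotonicity makes this harmless, and the permuted m-set is uniform. *)
have [|S sS Sm] := @superset_card T [set x in s] m _ mT.
  by apply: leq_trans Nm; rewrite -hs cardsE card_size.
rewrite -(perm_sum_prob R E Sm); apply: ler_wpM2l; first by rewrite invr_ge0 ler0n.
apply: ler_sum => p _; rewrite /g ler_nat.
case: asboolP => // h; rewrite asboolT //; apply: mono h; exact: imsetS.
Qed.

(** * Parameters and conclusion *)

Lemma prob_subset_ge0 (R : realType) (T : finType) m (E : {set T} -> Prop) :
  0 <= prob_subset R m E.
Proof. by rewrite /prob_subset divr_ge0. Qed.

Lemma prob_subset_le (R : realType) (T : finType) m (E F : {set T} -> Prop) :
  (forall S, E S -> F S) -> prob_subset R m E <= prob_subset R m F.
Proof.
move=> h; rewrite /prob_subset ler_wpM2r ?invr_ge0 // ler_nat.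
apply: subset_leq_card; apply/subsetP => S; rewrite !inE => /andP [-> /asboolP hS].
by apply/asboolP; exact: h.
Qed.

Lemma ln2_ge (R : realType) : 2^-1 <= ln 2 :> R.
Proof.
have h := @le_ln1Dx R (- 2^-1); have : -1 < - 2^-1 :> R by lra.
move=> /h; rewrite (_ : 1 + - 2^-1 = 2^-1); last by lra.
by rewrite lnV ?posrE //; lra.
Qed.

Lemma ln_le_id (R : realType) (x : R) : 0 < x -> ln x <= x.
Proof.
move=> x0; have := @le_ln1Dx R (x - 1).
rewrite (_ : 1 + (x - 1) = x); last by ring.
by move=> h; apply: le_trans (h _) _; lra.
Qed.

Lemma dot_isom (R : realFieldType) n r (U : 'M[R]_(n, r)) :
  U^T *m U = 1%:M -> dot U U = r%:R.
Proof. by move=> hU; rewrite /dot hU mxtrace1. Qed.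

Lemma norm2_row (R : realType) n r (U : 'M[R]_(n, r)) i :
  norm2 (U^T *m std_basis R i) ^+ 2 = dot (row i U) (row i U).
Proof.
rewrite /norm2 sqr_sqrtr; last by apply: sumr_ge0 => j _; exact: sqr_ge0.
by rewrite -dot_cV /std_basis -colE -row_trmx_col trmxK.
Qed.

(** The squared row norms of U add up to r, and the bounds add up to mu r, whence 1 <= mu. *)
Lemma incoherent_row (R : realType) n r (U : 'M[R]_(n, r)) (mu : R) :
  (0 < r)%N -> (0 < n)%N -> U^T *m U = 1%:M ->
  (forall i, norm2 (U^T *m std_basis R i) <= Num.sqrt (mu * r%:R / n%:R)) ->
  1 <= mu /\ forall i, dot (row i U) (row i U) <= mu * r%:R / n%:R.
Proof.
move=> r0 n0 hU h; set x := mu * r%:R / n%:R in h *.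
have r0' : (0 : R) < r%:R by rewrite ltr0n.
have n0' : (0 : R) < n%:R by rewrite ltr0n.
have hy i : dot (row i U) (row i U) <= Num.sqrt x ^+ 2.
  by rewrite -norm2_row; apply: lerXn2r; rewrite ?nnegrE ?sqrtr_ge0.
have hr : r%:R <= n%:R * Num.sqrt x ^+ 2.
  rewrite -(dot_isom hU) dot_rows mulr_natl -[X in _ *+ X]card_ord -sumr_const.
  exact: ler_sum.
(* [Num.sqrt] is 0 on negative numbers, so a negative bound would make the sum of the squared rows,
   which is r, at most 0. *)
have x0 : 0 <= x.
  rewrite leNgt; apply/negP => xn; move: hr; rewrite ler0_sqrtr ?(ltW xn) //.
  by rewrite expr0n mulr0 leNgt r0'.
rewrite sqr_sqrtr // in hy hr; split=> //.
rewrite -(ler_pM2r r0') mul1r; apply: le_trans hr _.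
by rewrite /x mulrC divfK // gt_eqF.
Qed.

Lemma opb_diag_mx (R : realFieldType) r (s : 'rV[R]_r) (a : R) :
  (forall i, 0 <= s 0 i <= a) -> opb a (diag_mx s).
Proof.
move=> h x; rewrite dot_diag_mx dot_rows mulr_sumr; apply: ler_sum => i _.
have /andP [h0 ha] := h i.
by apply: ler_wpM2r; [exact: dot_ge0|apply: lerXn2r; rewrite ?nnegrE // (le_trans h0)].
Qed.

Lemma svd_bounded (R : realType) n1 n2 r (U : 'M[R]_(n1, r)) (V : 'M[R]_(n2, r))
    (s : 'rV[R]_r) (p1 p2 a : R) :
  U^T *m U = 1%:M -> V^T *m V = 1%:M ->
  (forall i, dot (row i U) (row i U) <= p1) ->
  (forall j, dot (row j V) (row j V) <= p2) ->
  (forall i, 0 <= s 0 i <= a) ->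
  bounded_by p1 p2 a (U *m diag_mx s *m V^T).
Proof.
move=> hU hV hu hv hs.
have rowb n n' p (U' : 'M[R]_(n, r)) (V' : 'M[R]_(n', r)) i : V'^T *m V' = 1%:M ->
    dot (row i U') (row i U') <= p ->
    \sum_j (U' *m diag_mx s *m V'^T) i j ^+ 2 <= p * a ^+ 2.
  move=> hV' hp; rewrite -dot_row !row_mul dot_mulr trmxK -mulmxA hV' mulmx1.
  rewrite -dot_trmx trmx_mul tr_diag_mx mulrC.
  apply: le_trans (opb_diag_mx hs _) _; rewrite dot_trmx.
  by apply: ler_wpM2l; first exact: sqr_ge0.
split=> [i j|i|j]; last first.
- under eq_bigr do rewrite -[U *m _ *m _]trmxK mxE.
  by rewrite !trmx_mul trmxK tr_diag_mx mulmxA; exact: rowb.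
- exact: rowb.
have := coord_sqr_le (U *m diag_mx s) (row j V)^T i.
have -> : (U *m diag_mx s *m (row j V)^T) i 0 = (U *m diag_mx s *m V^T) i j.
  by rewrite tr_row colE mulmxA -colE mxE.
move=> h; apply: le_trans h _; rewrite dot_trmx mulrAC; apply: ler_pM; rewrite ?dot_ge0 //.
have := rowb n1 n2 p1 U V i hV (hu i).
rewrite -dot_row !row_mul dot_mulr trmxK -mulmxA hV mulmx1; exact.
Qed.

(** The event carried from sequences to subsets: a matrix supported on Omega is supported on every
    larger set, which gives the monotonicity needed there. *)
Definition certificate (R : realType) n1 n2 r (X : 'M[R]_(n1, n2)) (U : 'M[R]_(n1, r))
    (V : 'M[R]_(n2, r)) (t : R) (Omega : {set 'I_n1 * 'I_n2}) : Prop :=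
  exists Y : 'M[R]_(n1, n2),
    [/\ forall i j, (i, j) \notin Omega -> Y i j = 0, PT U V Y = X & opb t (Y - X)].

(** One [t] pays for the golfing part off T, the other for the correction, whose Frobenius norm is
    estimated by adding the row bounds of the residual over the n1 rows. *)
Lemma Pseq_certificate (R : realType) n1 n2 r (U : 'M[R]_(n1, r)) (V : 'M[R]_(n2, r))
    (X : 'M[R]_(n1, n2)) (p1 p2 be k l A t : R) q L (N := (n1 * n2)%:R : R) :
  (0 < n1 * n2)%N -> (0 < q)%N -> 0 < be -> 1 <= k ->
  2 ^+ 17 * k ^+ 2 * be * l <= q%:R ->
  0 < p1 -> 0 < p2 -> N * p1 <= be -> N * p2 <= be ->
  U^T *m U = 1%:M -> V^T *m V = 1%:M ->
  (forall i, dot (row i U) (row i U) <= p1) ->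
  (forall j, dot (row j V) (row j V) <= p2) ->
  0 < A -> PT U V X = X -> bounded_by p1 p2 A X ->
  A / (4 * k) <= t -> 2 * N * (n1%:R * (p1 * (A / (2 * k) ^+ L) ^+ 2)) <= t ^+ 2 ->
  1 - (L%:R * batch_err n1 n2 r l + 2 * (n1 * n2 + n1 * n2)%:R * expR (- (32 * l))) <=
  Pseq R (L * q + q) (fun s => certificate X U V (t + t) [set x in s]).
Proof.
move=> N0 q0 be0 k1 hq p10 p20 hp1 hp2 hU hV hu hv A0 XT hX At ht.
have T0 : (0 < #|{: 'I_n1 * 'I_n2}|)%N by rewrite card_prod !card_ord.
have k0 : 0 < k by exact: lt_le_trans k1.
have A4 : 0 <= A / (4 * k) by rewrite divr_ge0 ?mulr_ge0 // ltW.
have t0 : 0 <= t by exact: le_trans At.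
apply: (Pseq_cat T0 _ (golfing N0 q0 be0 k1 hq p10 p20 hp1 hp2 hU hV hu hv L A0 XT hX)
  (Q := fun _ s' => size s' = q /\ forall Z : 'M[R]_(n1, n2), PT U V Z = Z ->
    dot Z Z <= 2 * dot Z (samp q s' Z))).
- by rewrite !mulr_ge0 ?expR_ge0.
- move=> s _; apply: le_trans (samp_coercive N0 q0 be0 k1 hq hp1 hp2 hU hV hu hv) _.
  by apply: Pseq_le.
move=> s s' [M [sM bM oM]] [hs' hc].
have WT : PT U V (X - PT U V M) = X - PT U V M by rewrite linearB /= XT PT_idem.
have [M' [sM' PM' dM']] := samp_correction hU hV q0 hs' hc WT.
have PTM : PT U V (M + M') = X by rewrite linearD /= PM' addrC subrK.
exists (M + M'); split=> //.
- move=> i j; rewrite inE => hij.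
  by apply: (supportedD (@supported_catl _ _ _ s s' _ sM) (@supported_catr _ _ _ s s' _ sM')) hij.
have -> : M + M' - X = (M - PT U V M) + (M' - PT U V M').
  by rewrite addrACA -opprD; congr (_ - _); rewrite PM' addrC subrK.
apply: opbD => //; first exact: opbW oM.
apply: opb_PTc => //; apply: opb_frob; apply: le_trans dM' _; apply: le_trans ht.
apply: ler_wpM2l; first by rewrite mulr_ge0.
rewrite dot_rows mulr_natl -[X in _ *+ X]card_ord -sumr_const; apply: ler_sum => i _.
by rewrite dot_row; case: bM.
Qed.

Lemma nat_between (R : realType) (x : R) : 0 <= x -> exists2 L : nat, x <= L%:R & L%:R <= x + 1.
Proof.
move=> x0; have /andP [h1 h2] := truncn_itv x0.
by exists (Num.truncn x).+1; [exact: ltW|rewrite -natr1 lerD2r].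
Qed.

(** With x = k^2 be l and lg = log_(2k) n, take L between 9 lg and 9 lg + 1, and q = floor (m / (L +
    1)). As lg >= 1, L + 1 <= 11 lg, so q + 1 >= 2^18 x; the unit lost in rounding is absorbed by
    half of 2^18 x. *)
Lemma batch_parameters (R : realType) (n m : nat) (k be : R) (l := ln n%:R) :
  (2 <= n)%N -> 1 <= k -> n%:R <= be -> (m <= n ^ 2)%N ->
  11 * 2 ^+ 18 * (k ^+ 2 * be * l * (l / ln (2 * k))) <= m%:R ->
  exists L q : nat, [/\ (0 < q)%N, (L * q + q <= m)%N,
    2 ^+ 17 * k ^+ 2 * be * l <= q%:R, (L%:R : R) <= 20 * n%:R &
    (n%:R : R) ^+ 9 <= (2 * k) ^+ L] /\ k ^+ 2 * be <= n%:R ^+ 2.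
Proof.
move=> n2 k1 nbe mn h.
have n2' : 2 <= n%:R :> R by rewrite ler_nat.
have n0 : 0 < n%:R :> R by apply: lt_le_trans n2'.
have k0 : 0 < k by exact: lt_le_trans k1.
have kk0 : 0 < 2 * k by rewrite mulr_gt0.
have l2 : 2^-1 <= l.
  by apply: le_trans (ln2_ge R) _; rewrite ler_ln // posrE.
have l0 : 0 < l by apply: lt_le_trans l2; rewrite invr_gt0.
have ln_n : l <= n%:R by exact: ln_le_id.
set D := ln (2 * k) in h.
have D2 : 2^-1 <= D.
  by apply: le_trans (ln2_ge R) _; rewrite ler_ln ?posrE //; lra.
have D0 : 0 < D by apply: lt_le_trans D2; rewrite invr_gt0.
have Dk : D <= 2 * k by exact: ln_le_id.
set x := k ^+ 2 * be * l in h; set lg := l / D in h.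
have lgD : lg * D = l by rewrite /lg divfK // gt_eqF.
have be0 : 0 < be by exact: lt_le_trans nbe.
have k2 : 1 <= k ^+ 2 by rewrite exprn_ege1.
have kbe : n%:R <= k ^+ 2 * be.
  by apply: le_trans nbe _; rewrite ler_peMl // ltW.
have x1 : 1 <= x.
  have : n%:R * 2^-1 <= x by apply: ler_pM => //; rewrite ?invr_ge0 // ltW.
  lra.
have lg0 : 0 <= lg by rewrite divr_ge0 // ltW.
have mn' : m%:R <= n%:R ^+ 2 :> R by rewrite -natrX ler_nat.
(* Otherwise n < 2k, and m <= n^2 with ln (2k) <= 2k, be >= n, l >= 1/2 would give 11 * 2^18 k^2 n /
   4 <= 2 k n^2 <= 4 k^2 n. *)
have lg1 : 1 <= lg.
  rewrite leNgt; apply/negP => lg1.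
  have lD : l < D by rewrite -lgD -ltr_pdivlMr // divff // gt_eqF.
  have nk : n%:R < 2 * k by rewrite -ltr_ln ?posrE.
  have h1 : 11 * 2 ^+ 18 * (k ^+ 2 * be * l * l) <= n%:R ^+ 2 * (2 * k).
    apply: le_trans (_ : (11 * 2 ^+ 18 * (x * lg)) * D <= _).
      by rewrite -{2}lgD /x le_eqVlt; apply/orP; left; apply/eqP; ring.
    apply: ler_pM; [|exact: ltW|exact: le_trans mn'|exact: Dk].
    by apply: mulr_ge0; [rewrite mulr_ge0 ?exprn_ge0|rewrite mulr_ge0 // (le_trans ler01)].
  have h2 : 11 * 2 ^+ 18 * (k ^+ 2 * n%:R * 4^-1) <= 11 * 2 ^+ 18 * (k ^+ 2 * be * l * l).
    apply: ler_wpM2l; first by rewrite mulr_ge0 ?exprn_ge0.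
    rewrite -[X in _ <= X]mulrA; apply: ler_pM.
    - by rewrite mulr_ge0 ?sqr_ge0 // ltW.
    - by rewrite invr_ge0.
    - by apply: ler_wpM2l; first exact: sqr_ge0.
    - rewrite (_ : 4^-1 = 2^-1 * 2^-1); last by rewrite -invfM -natrM.
      by apply: ler_pM; rewrite ?invr_ge0.
  have h3 : n%:R ^+ 2 * (2 * k) <= n%:R * (2 * k) * (2 * k).
    by rewrite expr2; apply: ler_wpM2r; [exact: ltW|apply: ler_wpM2l; exact: ltW].
  have kn : 0 < k ^+ 2 * n%:R by rewrite mulr_gt0 // exprn_gt0.
  have : 11 * 2 ^+ 18 * (k ^+ 2 * n%:R * 4^-1) <= 4 * (k ^+ 2 * n%:R).
    by apply: le_trans h2 (le_trans h1 (le_trans h3 _)); rewrite le_eqVlt; apply/orP; left; apply/eqP; ring.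
  have e18 : 1 <= 2 ^+ 18 :> R by rewrite exprn_ege1 // ler1n.
  have : 11 * (k ^+ 2 * n%:R * 4^-1) * 2 <= 11 * 2 ^+ 18 * (k ^+ 2 * n%:R * 4^-1).
    rewrite mulrAC; apply: ler_wpM2r; first by rewrite mulr_ge0 ?invr_ge0 // ltW.
    by rewrite ler_wpM2l // exprS ler_peMr // exprn_ege1 // ler1n.
  lra.
have [L L1 L2] := nat_between (mulr_ge0 (ler0n R 9) (le_trans ler01 lg1)).
have L11 : L.+1%:R <= 11 * lg by rewrite -natr1; lra.
exists L, (m %/ L.+1)%N.
have hq : 2 ^+ 17 * x <= (m %/ L.+1)%:R :> R.
  have := ltn_ceil m (ltn0Sn L); rewrite -(ltr_nat R) natrM => hc.
  have h1 : 2 ^+ 18 * x * L.+1%:R <= (m %/ L.+1).+1%:R * L.+1%:R.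
    apply: le_trans (ltW hc); apply: le_trans h.
    rewrite (_ : 11 * _ * _ = 2 ^+ 18 * x * (11 * lg)); last by ring.
    by apply: ler_wpM2l => //; rewrite mulr_ge0 ?exprn_ge0 // (le_trans ler01).
  rewrite ler_pM2r ?ltr0n // -natr1 exprS in h1.
  have e17 : 1 <= 2 ^+ 17 :> R by rewrite exprn_ege1 // ler1n.
  have : 1 * 1 <= 2 ^+ 17 * x by apply: ler_pM.
  lra.
have q0 : (0 < m %/ L.+1)%N.
  rewrite -(ltr_nat R); apply: lt_le_trans hq.
  by rewrite mulr_gt0 ?exprn_gt0 // (lt_le_trans ltr01).
have lgl : lg <= 2 * l.
  have : lg * 2^-1 <= l by rewrite -[leRHS]lgD; apply: ler_wpM2l.
  lra.
split; [split=> //|].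
- by rewrite addnC -mulSn mulnC leq_trunc_div.
- by move: hq; rewrite /x !mulrA.
- lra.
- have -> : (n%:R : R) ^+ 9 = expR (9 * l).
    by rewrite expRM_natl lnK // posrE.
  have -> : (2 * k) ^+ L = expR (L%:R * D).
    by rewrite expRM_natl lnK // posrE.
  by rewrite ler_expR -lgD mulrA; apply: ler_wpM2r => //; exact: ltW.
apply: le_trans (le_trans h mn').
rewrite (_ : 11 * _ * _ = k ^+ 2 * be * (11 * 2 ^+ 18 * (l * lg))); last by rewrite /x; ring.
apply: ler_peMr; first by rewrite mulr_ge0 ?sqr_ge0 // ltW.
have e18 : 1 <= 2 ^+ 18 :> R by rewrite exprn_ege1 // ler1n.
have llg : 2^-1 * 1 <= l * lg by apply: ler_pM; rewrite ?invr_ge0.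
have : 11 * 1 * (2^-1 * 1) <= 11 * 2 ^+ 18 * (l * lg).
  apply: ler_pM llg; rewrite ?mulr_ge0 ?invr_ge0 //.
  by apply: ler_wpM2l.
lra.
Qed.

(** Each exponential is n^(-32), and the prefactors add up to at most 160 n^3 + 4 n^2 <= 2^8 n^3 <=
    n^22 for n >= 2. *)
Lemma failure_bound (R : realType) (n n1 n2 r L : nat) (l := ln n%:R : R) :
  (2 <= n)%N -> (n1 <= n)%N -> (n2 <= n)%N -> (r <= n)%N -> L%:R <= 20 * n%:R :> R ->
  L%:R * batch_err n1 n2 r l + 2 * (n1 * n2 + n1 * n2)%:R * expR (- (32 * l)) <=
  n%:R ^- 10.
Proof.
move=> n2' h1 h2 hr hL.
have n0 : 0 < n%:R :> R by rewrite ltr0n (leq_trans _ n2').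
have -> : expR (- (32 * l)) = n%:R ^- 32 :> R.
  by rewrite expRN expRM_natl lnK // posrE.
rewrite /batch_err.
have -> : expR (- (32 * l)) = n%:R ^- 32 :> R.
  by rewrite expRN expRM_natl lnK // posrE.
rewrite -(ler_pM2r (exprn_gt0 32 n0)).
have zw : n%:R ^- 32 * n%:R ^+ 32 = 1 :> R by rewrite mulVf // expf_neq0 // gt_eqF.
set z := n%:R ^- 32 in zw *.
rewrite [leLHS](_ : _ = (L%:R * (n1 + n2)%:R * (2 * (2 + r)%:R) +
  2 * (n1 * n2 + n1 * n2)%:R) * (z * n%:R ^+ 32)); last by ring.
rewrite zw mulr1.
have -> : n%:R ^- 10 * n%:R ^+ 32 = n%:R ^+ 22 :> R.
  rewrite (_ : 32%N = (10 + 22)%N) // exprD mulKf // expf_neq0 // gt_eqF //.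
apply: le_trans (_ : (20 * n%:R) * (2 * n)%:R * (2 * (2 * n)%:R) + 2 * (2 * n ^ 2)%:R <= _).
  apply: lerD.
    apply: ler_pM; rewrite ?mulr_ge0 //.
      by apply: ler_pM => //; rewrite ler_nat; lia.
    by apply: ler_wpM2l => //; rewrite ler_nat; lia.
  rewrite -!natrM ler_nat; apply: leq_mul => //.
  by rewrite mul2n -addnn; apply: leq_add; rewrite -mulnn; exact: leq_mul.
rewrite -!natrM -natrD -natrX ler_nat.
have e : (n ^ 22 = n ^ 19 * n ^ 3)%N by rewrite -expnD.
have e3 : (n ^ 3 = n * n * n)%N by rewrite !expnS expn0 muln1 mulnA.
have p19 : (2 ^ 8 <= n ^ 19)%N.
  by apply: leq_trans (_ : 2 ^ 19 <= _)%N; [rewrite leq_exp2l|rewrite leq_exp2r].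
apply: leq_trans (_ : 2 ^ 8 * n ^ 3 <= _)%N; last by rewrite e leq_mul2r p19 orbT.
rewrite e3 (_ : 2 ^ 8 = 256)%N // -mulnn; nia.
Qed.

Theorem theorem2 (R : realType) :
  exists c : R, 0 < c /\
  forall (n1 n2 r m : nat) (mu : R) (X : 'M[R]_(n1, n2))
    (U : 'M[R]_(n1, r)) (s : 'rV[R]_r) (V : 'M[R]_(n2, r)),
    (0 < r)%N ->
    \rank X = r ->
    skinny_svd X U s V ->
    incoherent mu U V ->
    (m <= n1 * n2)%N ->
    c * cond_number s ^+ 2 * mu * (maxn n1 n2)%:R * r%:R
      * ln (maxn n1 n2)%:R * logb (2 * cond_number s) (maxn n1 n2)%:R
      <= m%:R ->
    1 - (maxn n1 n2)%:R ^- 10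
      <= prob_subset R m
           (fun Omega : {set 'I_n1 * 'I_n2} => unique_solution r X Omega).

Proof.
exists (11 * 2 ^+ 18); split; first by rewrite mulr_gt0 ?exprn_gt0.
move=> n1 n2 r m mu X U s V r0 rX svd inc mN.
set n := maxn n1 n2; set k := cond_number s => hm.
have [hU hV s0 smono hX] := svd.
have r1 : (r <= n1)%N by rewrite -rX rank_leq_row.
have r2 : (r <= n2)%N by rewrite -rX rank_leq_col.
have n10 : (0 < n1)%N by exact: leq_trans r1.
have n20 : (0 < n2)%N by exact: leq_trans r2.
have n1n : (n1 <= n)%N by exact: leq_maxl.
have n2n : (n2 <= n)%N by exact: leq_maxr.
(* For n = 1 the probability to be reached is 0. *)
have [n1'|n2'] := leqP n 1.
  have -> : n = 1%N by apply/eqP; rewrite eqn_leq n1' (leq_trans n10).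
  by rewrite expr1n invr1 subrr prob_subset_ge0.
(* sigma_1 and sigma_r are the entries 0 and r - 1 of [s]; r > 0 keeps both clear of the default
   value of [sing_val]. *)
pose i1 : 'I_r := Ordinal r0.
have rr : (r.-1 < r)%N by rewrite ltn_predL.
pose ir : 'I_r := Ordinal rr.
set a := s 0 i1; set b := s 0 ir.
have hk : k = a / b.
  rewrite /k /cond_number /sing_val (insubT (fun i => i < r)%N r0).
  by rewrite (insubT (fun i => i < r)%N rr).
have a0 : 0 < a by exact: s0.
have b0 : 0 < b by exact: s0.
have sa i : 0 <= s 0 i <= a by rewrite ltW //= smono.
have sb i : b <= s 0 i by apply: smono; rewrite /= -ltnS prednK.
have k1 : 1 <= k by rewrite hk ler_pdivlMr // mul1r; case/andP: (sa ir).
have k0 : 0 < k by exact: lt_le_trans k1.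
have abk : a = k * b by rewrite hk divfK // gt_eqF.
have [mu1 hu] := incoherent_row r0 n10 hU inc.1.
have [_ hv] := incoherent_row r0 n20 hV inc.2.
have mr1 : 1 <= mu * r%:R.
  apply: le_trans (mu1) _; apply: ler_peMr; first exact: le_trans mu1.
  by rewrite ler1n.
have mr0 : 0 < mu * r%:R by exact: lt_le_trans mr1.
have n10' : (0 : R) < n1%:R by rewrite ltr0n.
have n20' : (0 : R) < n2%:R by rewrite ltr0n.
have n0' : (0 : R) < n%:R by rewrite ltr0n (leq_trans n10).
(* A common bound for n1 n2 p1 = n2 mu r and n1 n2 p2 = n1 mu r. *)
pose be := n%:R * (mu * r%:R).
have be0 : 0 < be by rewrite mulr_gt0.
have nbe : n%:R <= be by rewrite ler_peMr // ltW.
have mn2 : (m <= n ^ 2)%N by apply: leq_trans mN _; rewrite -mulnn leq_mul.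
have hm' : 11 * 2 ^+ 18 * (k ^+ 2 * be * ln n%:R * (ln n%:R / ln (2 * k))) <= m%:R.
  by apply: le_trans hm; rewrite /logb /be le_eqVlt; apply/orP; left; apply/eqP; ring.
have [L [q [[q0 Lqm hq L20 kL] kbe]]] := batch_parameters n2' k1 nbe mn2 hm'.
set p1 := mu * r%:R / n1%:R in hu; set p2 := mu * r%:R / n2%:R in hv.
have p10 : 0 < p1 by rewrite divr_gt0.
have p20 : 0 < p2 by rewrite divr_gt0.
have N0 : (0 < n1 * n2)%N by rewrite muln_gt0 n10.
have Np1 : (n1 * n2)%:R * p1 <= be.
  rewrite natrM (_ : _ * p1 = n2%:R * (mu * r%:R)); last by rewrite /p1; field; rewrite gt_eqF.
  by rewrite ler_pM2r // ler_nat.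
have Np2 : (n1 * n2)%:R * p2 <= be.
  rewrite natrM (_ : _ * p2 = n1%:R * (mu * r%:R)); last by rewrite /p2; field; rewrite gt_eqF.
  by rewrite ler_pM2r // ler_nat.
have XT : PT U V X = X by rewrite hX PT_svd.
have bX : bounded_by p1 p2 a X by rewrite hX; exact: svd_bounded.
(* Since a = k b this is an equality. The golfing part and the correction each get b / 4, in total b
   / 2 < sigma_r. *)
have t1 : a / (4 * k) <= b / 4.
  by rewrite abk le_eqVlt; apply/orP; left; apply/eqP; field; rewrite gt_eqF.
(* The left side equals 2 n1 n2 k^2 mu r b^2 / d^2 with d = (2k)^L >= n^9. The bound k^2 be <= n^2
   gives k^2 mu r <= n, so 32 n^3 <= n^18 is enough. *)
have t2 : 2 * (n1 * n2)%:R * (n1%:R * (p1 * (a / (2 * k) ^+ L) ^+ 2)) <= (b / 4) ^+ 2.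
  have muk : k ^+ 2 * (mu * r%:R) <= n%:R.
    by rewrite -(ler_pM2l n0') -expr2; apply: le_trans kbe; rewrite /be le_eqVlt; apply/orP; left; apply/eqP; ring.
  set d := (2 * k) ^+ L in kL *.
  have n9 : 0 < n%:R ^+ 9 :> R by rewrite exprn_gt0.
  have d0 : 0 < d by exact: lt_le_trans kL.
  have -> : 2 * (n1 * n2)%:R * (n1%:R * (p1 * (a / d) ^+ 2)) =
     2 * (n1 * n2)%:R * (k ^+ 2 * (mu * r%:R)) * b ^+ 2 / d ^+ 2.
    by rewrite /p1 abk; field; rewrite !gt_eqF.
  rewrite ler_pdivrMr; last exact: exprn_gt0.
  rewrite [leRHS](_ : _ = d ^+ 2 / 16 * b ^+ 2); last by field.
  apply: ler_wpM2r; first exact: sqr_ge0.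
  apply: le_trans (_ : 2 * n%:R ^+ 2 * n%:R <= _).
    apply: ler_pM muk; [by rewrite mulr_ge0| |].
    - by apply: mulr_ge0; [exact: sqr_ge0|exact: ltW].
    - by apply: ler_wpM2l => //; rewrite -natrX ler_nat -mulnn leq_mul.
  have d18 : n%:R ^+ 18 <= d ^+ 2.
    by rewrite (_ : 18%N = (9 * 2)%N) // exprM; apply: lerXn2r; rewrite ?nnegrE // ltW.
  have n5 : 32 * n%:R ^+ 3 <= n%:R ^+ 18 :> R.
    rewrite -natrX -natrM -natrX ler_nat (_ : n ^ 18 = n ^ 15 * n ^ 3)%N; last by rewrite -expnD.
    rewrite leq_mul2r; apply/orP; right.
    by apply: leq_trans (_ : 2 ^ 15 <= _)%N; rewrite // leq_exp2r.
  have -> : 2 * n%:R ^+ 2 * n%:R = 2 * n%:R ^+ 3 :> R by ring.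
  lra.
have t0 : 0 <= b / 4 by rewrite divr_ge0 // ltW.
have T0 : (0 < #|{: 'I_n1 * 'I_n2}|)%N by rewrite card_prod !card_ord.
have hP := Pseq_certificate N0 q0 be0 k1 hq p10 p20 Np1 Np2 hU hV hu hv a0 XT bX t1 t2.
apply: le_trans (_ : prob_subset R m (certificate X U V (b / 4 + b / 4)) <= _); last first.
  apply: prob_subset_le => Omega [Y [sY PY oY]].
  apply: (certificate_unique r0 svd sY PY _ _ oY); first exact: addr_ge0.
  by move=> i; apply: lt_le_trans (sb i); lra.
apply: le_trans (Pseq_le_prob_subset R T0 Lqm _ _); last first.
- move=> A B AB [Y [sY PY oY]]; exists Y; split=> // i j hij; apply: sY.
  by apply: contra hij; exact: (subsetP AB).
- by rewrite card_prod !card_ord.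
apply: le_trans hP; rewrite lerD2l lerN2.
by apply: failure_bound => //; exact: leq_trans n1n.
Qed.
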